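(* Let $m_\pm$ be Herglotz functions, with associated whole line canonical system $H$, and suppose that $$\pm m_\pm(z)=T(z)\bigl(\pm m_\pm(z)\bigr)\qquad(z\in\mathbb C^+)$$ for some $T\in\mathcal{SL}$ that is not identically equal to $1$ and not identically equal to $-1$. Let $$E=\{x\in\mathbb R:-2\le\operatorname{tr}T(x)\le2\}.$$ Then $H\in\mathcal R^C_0(E)$, that is, $H$ is reflectionless on $E$ and $\sigma(H)\subseteq E$. Moreover, $E$ is a union of disjoint closed intervals (possibly unbounded or consisting of single points) whose endpoints do not accumulate anywhere.
   Context: $\mathbb C^+=\{z:\operatorname{Im}z>0\}$. A Herglotz function is a holomorphic function $m:\mathbb C^+\to\mathbb C^+$. $\mathcal{SL}$ is the group of entire functions $T:\mathbb C\to SL(2,\mathbb C)$ with $T(x)\in SL(2,\mathbb R)$ for $x\in\mathbb R$. A matrix $\begin{pmatrix}a&b\\c&d\end{pmatrix}$ followed by a number $w$ denotes the linear fractional transformation $w\mapsto\frac{aw+b}{cw+d}$. The hypothesis means two identities, one for the upper signs and one for the lower signs. By the one-to-one correspondence between Herglotz functions and trace normed canonical systems, a pair $m_\pm$ is identified with a whole line canonical system, and $H$ is short-hand notation for the pair $m_\pm$. $H$ is reflectionless on a Borel set $A\subseteq\mathbb R$ if $m_+(x)=-\overline{m_-(x)}$ for almost every $x\in A$, where $m_\pm(x)=\lim_{y\to0+}m_\pm(x+iy)$. The spectral properties of $H$ are those of the operator of multiplication by the variable in $L^2(\mathbb R,d\rho)$, where $\rho$ is the matrix valued measure from the Herglotz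 representation of $$M(z)=\frac1{m_+(z)+m_-(z)}\begin{pmatrix}-1&\frac12(m_+(z)-m_-(z))\\\frac12(m_+(z)-m_-(z))&m_+(z)m_-(z)\end{pmatrix};$$ in particular $\sigma(H)$ is the spectrum of this operator, i.e. the topological support of $\rho$. $\mathcal R^C_0(K)$ denotes the set of canonical systems $H$ that are reflectionless on $K$ and satisfy $\sigma(H)\subseteq K$. *)

(* Defs.v *)
From HB Require Import structures.
From mathcomp Require Import all_boot all_order all_algebra.
From mathcomp Require Import complex.
From mathcomp Require Import all_classical all_reals all_analysis.

Set Implicit Arguments.
Unset Strict Implicit.
Unset Printing Implicit Defensive.

Import Order.TTheory GRing.Theory Num.Theory.
Import numFieldNormedType.Exports.

Local Open Scope classical_set_scope.
Local Open Scope ring_scope.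
Local Open Scope complex_scope.

(* Complex differentiability at z: [derivable] over the scalar field R[i], in
   the direction 1, is the existence of the limit of (f (z + h) - f z) / h as
   the complex number h tends to 0. *)
Definition holomorphic_at (R : realType) (f : R[i] -> R[i]) (z : R[i]) : Prop :=
  derivable (f : R[i]^o -> R[i]^o) z 1.

Definition upper_half_plane (R : realType) (z : R[i]) : Prop :=
  0 < complex.Im z.

(* Only the values of m on the upper half-plane are meaningful. *)
Definition herglotz (R : realType) (m : R[i] -> R[i]) : Prop :=
  forall z, upper_half_plane z ->
    holomorphic_at m z /\ upper_half_plane (m z).

(* The group SL of entire SL(2,C)-valued functions that are real on R. *)
Definition entire_SL (R : realType) (T : R[i] -> 'M[R[i]]_2) : Prop :=
  [/\ forall z i j, holomorphic_at (fun w => T w i j) z,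
      forall z, \det (T z) = 1 &
      forall x : R, exists S : 'M[R]_2, T x%:C = map_mx (real_complex R) S].

(* As 1 / 0 = 0 in R[i], the value is 0 at a pole of the transformation; so
   [lft A w = w] with w != 0 does force the denominator to be nonzero. *)
Definition lft (R : realType) (A : 'M[R[i]]_2) (w : R[i]) : R[i] :=
  (A 0 0 * w + A 0 1) / (A 1 0 * w + A 1 1).

Definition boundary_value (R : realType) (m : R[i] -> R[i]) (x : R) (w : R[i])
    : Prop :=
  (m (x +i* y) : R[i]^o) @[y --> (0 : R)^'+] --> (w : R[i]^o).

(* A whole line canonical system is identified with its pair (m_+, m_-) of
   Herglotz functions. *)
Definition canonical_system (R : realType) : Type :=
  ((R[i] -> R[i]) * (R[i] -> R[i]))%type.

(* At almost every point of A both boundary values are required to exist. *)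
Definition reflectionless (R : realType) (H : canonical_system R) (A : set R)
    : Prop :=
  {ae (@lebesgue_measure R), forall x : R, A x ->
    exists wp wm : R[i],
      [/\ boundary_value H.1 x wp, boundary_value H.2 x wm & wp = - wm^*]}.

Definition M_matrix (R : realType) (H : canonical_system R) (z : R[i])
    : 'M[R[i]]_2 :=
  let p := H.1 z in
  let q := H.2 z in
  \matrix_(i, j)
    ((p + q)^-1 *
     (if i == j then (if i == 0 then -1 else p * q) else (p - q) / 2%:R)).

Definition symmetric_psd (R : realType) (A : 'M[R]_2) : Prop :=
  A^T = A /\ forall v : 'rV[R]_2, 0 <= (v *m A *m v^T) 0 0.

(* A locally finite measure on R with values in the positive semidefinite real
   symmetric 2 x 2 matrices. Each entry is a locally finite signed measure,
   which in general has no value on unbounded sets; it is given as a difference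
   of two positive measures. *)
Record matrix_measure (R : realType) : Type := MatrixMeasure {
  mm_pos : 'I_2 -> 'I_2 -> {measure set (measurableTypeR R) -> \bar R};
  mm_neg : 'I_2 -> 'I_2 -> {measure set (measurableTypeR R) -> \bar R};
  mm_val := fun A : set (measurableTypeR R) =>
    \matrix_(i < 2, j < 2) (fine (mm_pos i j A) - fine (mm_neg i j A));
  mm_finite : forall i j (A : set (measurableTypeR R)),
    measurable A -> bounded_set (A : set R) ->
    (mm_pos i j A < +oo)%E /\ (mm_neg i j A < +oo)%E;
  mm_psd : forall A : set (measurableTypeR R),
    measurable A -> bounded_set (A : set R) -> symmetric_psd (mm_val A)
}.

Definition mm_support (R : realType) (rho : matrix_measure R) : set R :=
  [set x | forall e : R, 0 < e -> mm_val rho (ball x e) != 0].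

Definition complex_integral (R : realType)
    (mu : {measure set (measurableTypeR R) -> \bar R}) (f : R -> R[i]) : R[i] :=
  Rintegral mu setT (fun t => complex.Re (f t)) +i*
  Rintegral mu setT (fun t => complex.Im (f t)).

Definition herglotz_kernel (R : realType) (z : R[i]) (t : R) : R[i] :=
  (t%:C - z)^-1 - (t / (1 + t ^+ 2))%:C.

(* rho is the measure in the Herglotz representation
     M(z) = A + B z + \int (1 / (t - z) - t / (1 + t^2)) d rho(t).
   For a symmetric M, the coefficients A, B and the measure rho are real
   symmetric. *)
Definition herglotz_measure (R : realType) (M : R[i] -> 'M[R[i]]_2)
    (rho : matrix_measure R) : Prop :=
  (forall i j,
     (mm_pos rho i j).-integrable setT (fun t : R => ((1 + t ^+ 2)^-1)%:E) /\
     (mm_neg rho i j).-integrable setT (fun t : R => ((1 + t ^+ 2)^-1)%:E)) /\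
  exists A B : 'M[R]_2, [/\ A^T = A, symmetric_psd B &
    forall z, upper_half_plane z -> forall i j,
      M z i j = (A i j)%:C + (B i j)%:C * z +
        (complex_integral (mm_pos rho i j) (herglotz_kernel z) -
         complex_integral (mm_neg rho i j) (herglotz_kernel z))].

(* The spectrum of multiplication by the variable in L^2(R, d rho), that is,
   the topological support of rho. By the Herglotz representation theorem rho
   exists and, as a matrix valued set function, is unique. *)
Definition spectrum (R : realType) (H : canonical_system R) : set R :=
  [set x | exists2 rho, herglotz_measure (M_matrix H) rho & mm_support rho x].

Definition R0C (R : realType) (K : set R) : set (canonical_system R) :=
  [set H | [/\ herglotz H.1, herglotz H.2, reflectionless H K &
               spectrum H `<=` K]].

Definition closed_interval (R : realType) (I : interval R) : Prop :=
  match I with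
  | Interval (BLeft _ | -oo%O) (BRight _ | +oo%O) => True
  | _ => False
  end.

Definition endpoints (R : realType) (I : interval R) : set R :=
  [set x | match I with
           | Interval (BSide _ a) (BSide _ b) => x = a \/ x = b
           | Interval (BSide _ a) (BInfty _) => x = a
           | Interval (BInfty _) (BSide _ b) => x = b
           | Interval (BInfty _) (BInfty _) => False
           end].

Definition disjoint_closed_interval_union (R : realType) (A : set R) : Prop :=
  exists F : set (interval R),
    [/\ forall I, F I -> closed_interval I /\ [set` I] !=set0,
        trivIset F (fun I => [set` I]),
        A = \bigcup_(I in F) [set` I] &
        limit_point (\bigcup_(I in F) endpoints I) = set0].

(* Main.v *)
Require Import Defs.
From mathcomp Require Import all_boot all_order all_algebra.
From mathcomp Require Import complex.
From mathcomp Require Import all_classical all_reals all_analysis.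
From mathcomp Require Import measurable_realfun ring lra.
Import Order.TTheory GRing.Theory Num.Theory.
Import numFieldNormedType.Exports.
Local Open Scope classical_set_scope.
Local Open Scope ring_scope.
Local Open Scope complex_scope.
Set Implicit Arguments.
Unset Strict Implicit.
Unset Printing Implicit Defensive.

(** Let [a, b, c, d] be the entries of [T z]. For [z] in the upper half-plane,
    [m_+] and [- m_-] are two fixed points of the same transformation and lie in
    opposite half-planes, hence they are the two roots of the quadratic equation
    [c w^2 + (d - a) w - b = 0]. Its discriminant is [tr T ^ 2 - 4], so
      [(c (m_+ + m_-))^2 = tr T ^ 2 - 4],  [c (m_+ - m_-) = a - d],
      [c m_+ m_- = b]   ([two_fixed_points]).
    All three parts of the theorem are read off from these identities on the real
    line, where [T] is real.

    Where [|tr T| < 2] the roots are conjugate and not real, the one in the upper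
    half-plane is the boundary value of [m_+] and the other one that of [- m_-]:
    this is the reflectionless identity ([reflectionless_at]). Where [|tr T| > 2]
    the squares [c^2 / (tr T ^ 2 - 4)] and [b^2 / (tr T ^ 2 - 4)] of the diagonal
    entries of [M] tend to nonnegative numbers, so the imaginary parts of these
    entries tend to 0 ([ImM_vanish]) and Stieltjes inversion leaves no mass there
    ([support_vanish]). Finally, the points with [|tr T| = 2] do not cluster
    ([disc_isolated]): otherwise the discriminant vanishes identically, the two
    distinct fixed points force [T] to be scalar, and [T] is 1 or -1. These points
    contain all boundary points of [E] and form a countable set, which gives the
    shape of [E] ([disjoint_closed_intervals]) and the exceptional null set.

    The clustering argument rests on the identity theorem for functions that are
    merely complex differentiable everywhere. Goursat's lemma, extended by
    continuity across the real axis, provides primitives for every continuous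
    function that is differentiable off the real axis ([primitive_off_axis]). A
    function with a twice iterated primitive obeys a maximum modulus estimate: for
    the second primitive it follows from a second difference test at an interior
    maximum, and it descends to derivatives through difference quotients
    ([maximum_modulus]). If [f] has infinitely many real zeros near a point, divide
    it by [n] of them; the quotient is continuous and differentiable off the real
    axis, so the estimate applies to it, and it yields [|f z| <= C / 2 ^ n] for
    every [n] ([identity_theorem]). *)

(** The norm of [R[i]] takes values in [R[i]] itself; estimates are linear
    arithmetic over [R], so they are stated with this real-valued version. *)
Notation modc := ComplexField.Normc.normc.

(** * The real-valued modulus of a complex number *)

Section Modulus.
Variable R : realType.
Implicit Types (z w : R[i]) (x : R).

Lemma normc_modc z : `|z| = (modc z)%:C.
Proof. by case: z. Qed.

Lemma modc_ge0 z : 0 <= modc z.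
Proof. by case: z => a b; exact: sqrtr_ge0. Qed.

Lemma modcD z w : modc (z + w) <= modc z + modc w.
Proof. exact: (@le_normcD R z w). Qed.

Lemma modcN z : modc (- z) = modc z.
Proof. exact: (@normcN R z). Qed.

Lemma modcB z w : modc (z - w) <= modc z + modc w.
Proof. by rewrite -(modcN w) modcD. Qed.

Lemma modcC z w : modc (z - w) = modc (w - z).
Proof. by rewrite -modcN opprB. Qed.

Lemma modcM z w : modc (z * w) = modc z * modc w.
Proof. exact: ComplexField.Normc.normcM. Qed.

Lemma modcV z : modc z^-1 = (modc z)^-1.
Proof. exact: ComplexField.Normc.normcV. Qed.

Lemma modc0 : modc (0 : R[i]) = 0.
Proof. exact: ComplexField.Normc.normc0. Qed.

Lemma modc1 : modc (1 : R[i]) = 1.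
Proof. exact: ComplexField.Normc.normc1. Qed.

Lemma modc_eq0 z : (modc z == 0) = (z == 0).
Proof.
by apply/eqP/eqP => [/ComplexField.Normc.eq0_normc//|->]; exact: modc0.
Qed.

Lemma modc_gt0 z : (0 < modc z) = (z != 0).
Proof. by rewrite lt0r modc_ge0 andbT modc_eq0. Qed.

Lemma modc_real x : modc x%:C = `|x|.
Proof. by rewrite /= expr0n addr0 sqrtr_sqr. Qed.

Lemma modc_i : modc ('i%C : R[i]) = 1.
Proof. by rewrite /= expr0n add0r expr1n sqrtr1. Qed.

Lemma modc_sqr z : modc z ^+ 2 = complex.Re z ^+ 2 + complex.Im z ^+ 2.
Proof. by case: z => a b; rewrite /= sqr_sqrtr // addr_ge0 ?sqr_ge0. Qed.

Lemma ler_Re_modc z : `|complex.Re z| <= modc z.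
Proof.
rewrite -(@ler_pXn2r _ 2%N) ?nnegrE ?modc_ge0 // modc_sqr real_normK ?num_real//.
by rewrite lerDl sqr_ge0.
Qed.

Lemma ler_Im_modc z : `|complex.Im z| <= modc z.
Proof.
rewrite -(@ler_pXn2r _ 2%N) ?nnegrE ?modc_ge0 // modc_sqr real_normK ?num_real//.
by rewrite lerDr sqr_ge0.
Qed.

Lemma modc_le z : modc z <= `|complex.Re z| + `|complex.Im z|.
Proof.
rewrite {1}[z]complexE; apply: (le_trans (modcD _ _)).
by rewrite modcM modc_i mul1r !modc_real.
Qed.

Lemma modc_sum_lb z w : modc z - modc w <= modc (z + w).
Proof. by rewrite lerBlDr -[X in modc X <= _](addrK w) modcB. Qed.

Lemma rcB (x y : R) : (x - y)%:C = x%:C - y%:C.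
Proof. exact: rmorphB. Qed.

Lemma complex_split (x y : R) : (x +i* y)%C = x%:C + 'i%C * y%:C.
Proof. by rewrite [LHS]complexE. Qed.

Lemma ReD z w : complex.Re (z + w) = complex.Re z + complex.Re w.
Proof. by case: z w => [? ?] []. Qed.
Lemma ImD z w : complex.Im (z + w) = complex.Im z + complex.Im w.
Proof. by case: z w => [? ?] []. Qed.
Lemma ReN z : complex.Re (- z) = - complex.Re z.
Proof. by case: z. Qed.
Lemma ImN z : complex.Im (- z) = - complex.Im z.
Proof. by case: z. Qed.
Lemma ReM z w : complex.Re (z * w) =
  complex.Re z * complex.Re w - complex.Im z * complex.Im w.
Proof. by case: z w => [? ?] []. Qed.
Lemma ImM z w : complex.Im (z * w) =
  complex.Re z * complex.Im w + complex.Im z * complex.Re w.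
Proof. by case: z w => [? ?] [? ?] /=; rewrite addrC. Qed.

Definition ReImE := (ReD, ImD, ReN, ImN, ReM, ImM).

End Modulus.

Arguments ComplexField.Normc.normc {R} x : simpl never.

(** * Continuity and complex derivatives *)

Lemma is_derive_epsP (K : numFieldType) (f : K^o -> K^o) (x l : K) :
  is_derive (x : K^o) 1 f l <->
  forall e : K, 0 < e -> exists2 d : K, 0 < d &
  forall w, `|w - x| < d -> `|f w - f x - l * (w - x)| <= e * `|w - x|.
Proof.
split.
- move=> [df dl] e e0.
  have H : (h^-1 *: (f (h *: 1 + x) - f x) : K^o) @[h --> (0:K^o)^'] --> ('D_1 f x : K^o) by [].
  rewrite dl in H; move/cvgrPdist_le : H => /(_ _ e0).
  rewrite /dnbhs /within /= => /nbhs_ballP[d /= d0 dP].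
  exists d => // w wr.
  have [->|wx] := eqVneq w x; first by rewrite !subrr mulr0 subrr normr0 mulr0.
  have wx0 : w - x != 0 by rewrite subr_eq0.
  have := dP (w - x); rewrite /ball /= sub0r normrN => /(_ wr wx0).
  rewrite [_ *: 1]mulr1 subrK.
  rewrite -(ler_pM2l (x := `|w - x|)) ?normr_gt0 // -normrM mulrBr.
  rewrite [_^-1 *: _]/(_^-1 * _) mulrA divff // mul1r.
  by rewrite (distrC (_ * _)) (mulrC _ l) (mulrC _ e).
- move=> fl.
  have : (h^-1 *: (f (h *: 1 + x) - f x) : K^o) @[h --> (0:K^o)^'] --> (l : K^o).
    apply/cvgrPdist_le => e e0.
    have [d d0 dP] := fl e e0.
    apply/nbhs_ballP; exists d => // h.
    rewrite /ball /= sub0r normrN => hd h0.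
    have := dP (h + x); rewrite addrK => /(_ hd).
    rewrite distrC => H.
    rewrite -(ler_pM2l (x := `|h|)) ?normr_gt0 // -normrM mulrBr.
    rewrite [h *: 1]mulr1 [h^-1 *: _]/(h^-1 * _) mulrA divff // mul1r.
    by rewrite (mulrC h) (mulrC _ e).
  move=> H; apply: DeriveDef; first by apply/cvg_ex; exists l.
  by rewrite /derive; apply: cvg_lim => //; exact: norm_hausdorff.
Qed.

Section Derivatives.
Variable R : realType.
Implicit Types (f g : R[i] -> R[i]) (z w l : R[i]).

Definition ccont f z := forall e : R, 0 < e -> exists2 d : R, 0 < d &
  forall w, modc (w - z) < d -> modc (f w - f z) < e.

(** The linear approximation error is bounded by [<= e * modc (w - z)], without
    division, so that [w = z] needs no separate treatment. *)
Definition cderiv f z l := forall e : R, 0 < e -> exists2 d : R, 0 < d &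
  forall w, modc (w - z) < d -> modc (f w - f z - l * (w - z)) <= e * modc (w - z).

Lemma ltc_real (e : R[i]) : 0 < e -> exists2 r : R, 0 < r & e = r%:C.
Proof.
case: e => a b; rewrite ltcE /= => /andP[/eqP -> a0]; by exists a.
Qed.

Lemma modc_ltE z (r : R) : (`|z| < r%:C) = (modc z < r).
Proof. by rewrite normc_modc ltcR. Qed.

Lemma cderivP f z l :
  cderiv f z l <-> is_derive (z : R[i]^o) 1 (f : R[i]^o -> R[i]^o) (l : R[i]^o).
Proof.
split.
- move=> fl; apply/is_derive_epsP => e /ltc_real[r r0 ->].
  have [d d0 dP] := fl r r0; exists d%:C; rewrite ?ltcR // => w.
  by rewrite modc_ltE !normc_modc -rmorphM /= lecR; exact: dP.
- move=> /is_derive_epsP H e e0.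
  have e0' : 0 < e%:C by rewrite ltcR.
  have [_ /ltc_real[d d0 ->] dP] := H _ e0'.
  exists d => // w wd; have := dP w.
  by rewrite modc_ltE !normc_modc -rmorphM /= lecR; exact.
Qed.

Lemma holomorphic_cderiv f z : holomorphic_at f z -> exists l, cderiv f z l.
Proof. by move=> /derivableP H; eexists; apply/cderivP; exact: H. Qed.

Lemma cderiv_ccont f z l : cderiv f z l -> ccont f z.
Proof.
move=> fl e e0; have [d d0 dP] := fl 1 ltr01.
have m0 : 0 <= modc l by exact: modc_ge0.
exists (Num.min d (e / (2 + modc l))).
  by rewrite lt_min d0 divr_gt0 //; lra.
move=> w; rewrite lt_min => /andP[/dP H1].
rewrite ltr_pdivlMr; last by lra.
move=> H2.
have := modc_sum_lb (f w - f z) (- (l * (w - z))); rewrite modcN modcM => H3.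
have := modc_ge0 (w - z); lra.
Qed.

Lemma cderivD f g z l m : cderiv f z l -> cderiv g z m ->
  cderiv (fun w => f w + g w) z (l + m).
Proof. by move=> /cderivP H /cderivP G; apply/cderivP; exact: is_deriveD. Qed.

Lemma cderivN f z l : cderiv f z l -> cderiv (fun w => - f w) z (- l).
Proof. by move=> /cderivP H; apply/cderivP; exact: is_deriveN. Qed.

Lemma cderivM f g z l m : cderiv f z l -> cderiv g z m ->
  cderiv (fun w => f w * g w) z (f z * m + g z * l).
Proof. by move=> /cderivP H /cderivP G; apply/cderivP; exact: is_deriveM. Qed.

Lemma cderiv_cst c z : cderiv (fun=> c) z 0.
Proof. by apply/cderivP; exact: is_derive_cst. Qed.

Lemma cderiv_id z : cderiv (fun w => w) z 1.
Proof. by apply/cderivP; exact: is_derive_id. Qed.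

Lemma cderiv_shift f z l c : cderiv f (z + c) l -> cderiv (fun w => f (w + c)) z l.
Proof.
move=> H e /H[d d0 dP]; exists d => // w wd.
have := dP (w + c); have -> : w + c - (z + c) = w - z by ring.
exact.
Qed.

Lemma cderivV z : z != 0 -> exists l, cderiv (fun w => w^-1) z l.
Proof.
move=> z0.
have : derivable ((fun w => w^-1) : R[i]^o -> R[i]^o) z 1.
  by apply: (@derivableV _ _ (id : R[i]^o -> R[i]^o)).
by move=> /derivableP H; eexists; apply/cderivP; exact: H.
Qed.

Lemma eq_cderiv f g z l (r : R) : 0 < r -> (forall w, modc (w - z) < r -> f w = g w) ->
  cderiv f z l -> cderiv g z l.
Proof.
move=> r0 fg H e /H[d d0 dP]; exists (Num.min d r); first by rewrite lt_min d0.
move=> w; rewrite lt_min => /andP[wd wr].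
by rewrite -!fg ?subrr ?modc0 //; exact: dP.
Qed.

End Derivatives.

(** * Paths in the complex plane *)

Section Paths.
Variable R : realType.
Implicit Types (u v : R -> R) (p q : R -> R[i]) (t a b : R) (l : R[i]).

Definition pderiv p t l := forall e : R, 0 < e -> exists2 d : R, 0 < d &
  forall s, `|s - t| < d -> modc (p s - p t - l * (s - t)%:C) <= e * `|s - t|.

Definition pcont p t := forall e : R, 0 < e -> exists2 d : R, 0 < d &
  forall s, `|s - t| < d -> modc (p s - p t) < e.

Lemma pderiv_pcont p t l : pderiv p t l -> pcont p t.
Proof.
move=> pl e e0; have [r r0 rP] := pl 1 ltr01.
have m0 := modc_ge0 l.
exists (Num.min r (e / (2 + modc l))).
  by rewrite lt_min r0 divr_gt0 //; lra.
move=> s; rewrite lt_min => /andP[/rP H1].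
rewrite ltr_pdivlMr; last by lra.
move=> H2; have := modc_sum_lb (p s - p t) (- (l * (s - t)%:C)).
rewrite modcN modcM modc_real => H3.
have := normr_ge0 (s - t); lra.
Qed.

Lemma pderivP p t l : pderiv p t l <->
  is_derive (t : R^o) 1 ((fun s => complex.Re (p s)) : R^o -> R^o) (complex.Re l) /\
  is_derive (t : R^o) 1 ((fun s => complex.Im (p s)) : R^o -> R^o) (complex.Im l).
Proof.
split=> [H|[/is_derive_epsP Hr /is_derive_epsP Hi]].
- split; apply/is_derive_epsP => e /H[d d0 dP]; exists d => // w /dP.
  + apply: le_trans; apply: le_trans (ler_Re_modc _).
    by rewrite !ReImE /= mulr0 subr0.
  + apply: le_trans; apply: le_trans (ler_Im_modc _).
    by rewrite !ReImE /= mulr0 add0r.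
- move=> e e0; have e2 : 0 < e / 2 by rewrite divr_gt0.
  have [d d0 dP] := Hr _ e2; have [d' d0' dP'] := Hi _ e2.
  exists (Num.min d d'); first by rewrite lt_min d0.
  move=> s; rewrite lt_min => /andP[/dP + /dP'] /=.
  move: (modc_le (p s - p t - l * (s - t)%:C)).
  by rewrite !ReImE /= !mulr0 subr0 add0r; lra.
Qed.

Lemma pcont_Re p t : pcont p t -> {for t, continuous (fun s => complex.Re (p s))}.
Proof.
move=> H; apply/cvgrPdist_lt => e /H[d d0 dP]; apply/nbhs_ballP; exists d => //.
move=> s; rewrite /ball /= distrC => /dP; apply: le_lt_trans.
rewrite distrC; apply: le_trans (ler_Re_modc _).
by rewrite !ReImE.
Qed.

Lemma pcont_Im p t : pcont p t -> {for t, continuous (fun s => complex.Im (p s))}.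
Proof.
move=> H; apply/cvgrPdist_lt => e /H[d d0 dP]; apply/nbhs_ballP; exists d => //.
move=> s; rewrite /ball /= distrC => /dP; apply: le_lt_trans.
rewrite distrC; apply: le_trans (ler_Im_modc _).
by rewrite !ReImE.
Qed.

Lemma cderiv_line (f : R[i] -> R[i]) z k t l : cderiv f (z + k * t%:C) l ->
  pderiv (fun s => f (z + k * s%:C)) t (l * k).
Proof.
move=> H e e0.
have k0 := modc_ge0 k.
have e0' : 0 < e / (1 + modc k) by rewrite divr_gt0 //; lra.
have [d d0 dP] := H _ e0'.
exists (d / (1 + modc k)); first by rewrite divr_gt0 //; lra.
move=> s; rewrite ltr_pdivlMr; last by lra.
move=> sd.
have E : z + k * s%:C - (z + k * t%:C) = k * (s - t)%:C by rewrite rmorphB /=; ring.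
have := dP (z + k * s%:C); rewrite E modcM modc_real mulrA.
have st := normr_ge0 (s - t).
have -> : modc k * `|s - t| < d by nra.
move=> /(_ isT) /le_trans; apply.
rewrite [e / _ * _]mulrA ler_wpM2r // -mulrA ler_piMr ?(ltW e0) //.
by rewrite mulrC ler_pdivrMr; lra.
Qed.

(** Mean value inequality; the complex version below applies it to the real and
    imaginary parts separately, which costs a factor 2 that is harmless in every
    later estimate. *)
Lemma real_mvt_le u (du : R -> R) a b M : a <= b ->
  (forall t, a <= t <= b -> is_derive (t : R^o) 1 (u : R^o -> R^o) (du t)) ->
  (forall t, a <= t <= b -> `|du t| <= M) ->
  `|u b - u a| <= M * (b - a).
Proof.
move=> ab H B.
have cu : {within `[a, b], continuous u}.
  apply: derivable_within_continuous => x; rewrite in_itv /= => xab.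
  by have [] := H x xab.
have H' x : x \in `]a, b[ -> is_derive x 1 u (du x).
  by rewrite in_itv /= => /andP[ax xb]; apply: H; rewrite !ltW.
have [c cab ->] := @MVT_segment R u du a b ab H' cu.
rewrite normrM (ger0_norm (x := b - a)) ?subr_ge0 // ler_wpM2r ?subr_ge0 //.
by apply: B; move: cab; rewrite in_itv.
Qed.

Lemma pmvt_le p (dp : R -> R[i]) a b M : a <= b ->
  (forall t, a <= t <= b -> pderiv p t (dp t)) ->
  (forall t, a <= t <= b -> modc (dp t) <= M) ->
  modc (p b - p a) <= 2 * M * (b - a).
Proof.
move=> ab H B; apply: (le_trans (modc_le _)).
have -> : 2 * M * (b - a) = M * (b - a) + M * (b - a) by ring.
apply: lerD.
- rewrite !ReImE.
  apply: (@real_mvt_le (fun s => complex.Re (p s)) (fun s => complex.Re (dp s))) => // t tab.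
    by have /pderivP[] := H t tab.
  by apply: le_trans (B t tab); exact: ler_Re_modc.
- rewrite !ReImE.
  apply: (@real_mvt_le (fun s => complex.Im (p s)) (fun s => complex.Im (dp s))) => // t tab.
    by have /pderivP[] := H t tab.
  by apply: le_trans (B t tab); exact: ler_Im_modc.
Qed.

Lemma eq_near_is_derive u v t (l r : R) : 0 < r ->
  (forall s, `|s - t| < r -> u s = v s) ->
  is_derive (t : R^o) 1 (u : R^o -> R^o) l -> is_derive (t : R^o) 1 (v : R^o -> R^o) l.
Proof.
move=> r0 uv /is_derive_epsP H; apply/is_derive_epsP => e /H[d d0 dP].
exists (Num.min d r); first by rewrite lt_min d0.
move=> s; rewrite lt_min => /andP[sd sr].
by rewrite -!uv ?subrr ?normr0 //; exact: dP.
Qed.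

(** The fundamental theorem of calculus differentiates [x |-> \int_n^x u] only to
    the right of the base point [n]; a primitive on the whole line is glued from
    these by moving the base point with [x] and normalising the value at [0]. *)
Lemma primitive_exists u : continuous u ->
  exists U : R -> R, forall t, is_derive (t : R^o) 1 (U : R^o -> R^o) (u t).
Proof.
move=> cu.
pose P (n x : R) := (\int[@lebesgue_measure R]_(t in [set` `[n, x]]) (u t)).
have PD (n x : R) : n < x -> is_derive (x : R^o) 1 (P n : R^o -> R^o) (u x).
  move=> nx.
  have xu : x < x + 1 by rewrite ltrDl.
  have [||D1 D2] := @continuous_FTC1_closed R u n x (x + 1) xu _ nx.
  - apply: continuous_compact_integrable; first exact: segment_compact.
    by apply: continuous_subspaceT => ?; exact: cu.
  - exact: cu.
  by apply: DeriveDef; [exact: D1|rewrite -derive1E; exact: D2].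
pose U x := P (- (`|x| + 1)) x - P (- (`|x| + 1)) 0.
have PU (n x : R) : - n < x -> 0 < n -> U x = P (-n) x - P (-n) 0.
  move=> nx n0.
  pose m := - (Num.min n (`|x| + 1)).
  have m0 : m < 0 by rewrite oppr_lt0 lt_min n0 /= addrC ltr_pwDl.
  have mx : m < x.
    rewrite ltrNl lt_min; apply/andP; split; first by lra.
    by have := ler_norm (-x); rewrite normrN; lra.
  have C : forall k, k < 0 -> k < x -> forall y, Num.min x 0 <= y <= Num.max x 0 ->
      is_derive (y : R^o) 1 (P k : R^o -> R^o) (u y).
    move=> k k0 kx y /andP[y1 _]; apply: PD; apply: lt_le_trans y1.
    by rewrite lt_min kx.
  have D k1 k2 : k1 < 0 -> k1 < x -> k2 < 0 -> k2 < x -> P k1 x - P k1 0 = P k2 x - P k2 0.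
    move=> a1 a2 b1 b2.
    have le0 : Num.min x 0 <= Num.max x 0 by rewrite ge_min !le_max !lexx.
    have := @real_mvt_le (P k1 - P k2) (fun y => u y - u y) _ _ 0 le0.
    rewrite mul0r => Z.
    have : `|(P k1 - P k2) (Num.max x 0) - (P k1 - P k2) (Num.min x 0)| <= 0.
      apply: Z => t tt; last by rewrite subrr normr0.
      by apply: is_deriveB; exact: C.
    rewrite normr_le0 subr_eq0 => /eqP.
    rewrite /= !fctE; case: (lerP x 0) => _; lra.
  by apply: D => //; have := normr_ge0 x; have := ler_norm (-x); rewrite normrN; lra.
exists U => t.
have n0 : 0 < `|t| + 2 by have := normr_ge0 t; lra.
have nt : - (`|t| + 2) < t by have := ler_norm (-t); rewrite normrN; lra.
apply: (@eq_near_is_derive (fun s => P (- (`|t| + 2)) s - P (- (`|t| + 2)) 0) _ _ _ 1) => //.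
  move=> s st; rewrite (PU (`|t| + 2)) //.
  have := ler_norm (-s); rewrite normrN.
  have : `|s| <= `|t| + `|s - t|.
    by rewrite addrC; have := ler_normD (s - t) t; rewrite subrK.
  by lra.
rewrite -[u t]subr0; apply: is_deriveB; exact: PD.
Qed.

Lemma pprimitive_exists p : (forall t, pcont p t) ->
  exists P, forall t, pderiv P t (p t).
Proof.
move=> cp.
have [U HU] := primitive_exists (fun t => pcont_Re (cp t)).
have [V HV] := primitive_exists (fun t => pcont_Im (cp t)).
by exists (fun t => U t +i* V t) => t; apply/pderivP; split; [exact: HU|exact: HV].
Qed.

Lemma pderivB p q t l m : pderiv p t l -> pderiv q t m ->
  pderiv (fun s => p s - q s) t (l - m).
Proof.
move=> H G e e0; have e2 : 0 < e / 2 by rewrite divr_gt0.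
have [d d0 dP] := H _ e2; have [d' d0' dP'] := G _ e2.
exists (Num.min d d'); first by rewrite lt_min d0.
move=> s; rewrite lt_min => /andP[/dP A /dP' B].
have -> : p s - q s - (p t - q t) - (l - m) * (s - t)%:C =
  (p s - p t - l * (s - t)%:C) - (q s - q t - m * (s - t)%:C) by ring.
by apply: (le_trans (modcB _ _)); lra.
Qed.

Lemma pderivD p q t l m : pderiv p t l -> pderiv q t m ->
  pderiv (fun s => p s + q s) t (l + m).
Proof.
move=> H G e e0; have e2 : 0 < e / 2 by rewrite divr_gt0.
have [d d0 dP] := H _ e2; have [d' d0' dP'] := G _ e2.
exists (Num.min d d'); first by rewrite lt_min d0.
move=> s; rewrite lt_min => /andP[/dP A /dP' B].
have -> : p s + q s - (p t + q t) - (l + m) * (s - t)%:C =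
  (p s - p t - l * (s - t)%:C) + (q s - q t - m * (s - t)%:C) by ring.
by apply: (le_trans (modcD _ _)); lra.
Qed.

Lemma pderiv_affine (c k : R[i]) (t0 : R) t :
  pderiv (fun s => c * (s - t0)%:C + k * ((s - t0) ^+ 2 / 2)%:C) t (c + k * (t - t0)%:C).
Proof.
move=> e e0; have k0 := modc_ge0 k.
exists (e / (1 + modc k)); first by rewrite divr_gt0 //; lra.
move=> s sd.
have -> : c * (s - t0)%:C + k * ((s - t0) ^+ 2 / 2)%:C -
   (c * (t - t0)%:C + k * ((t - t0) ^+ 2 / 2)%:C) -
   (c + k * (t - t0)%:C) * (s - t)%:C = k * ((s - t) ^+ 2 / 2)%:C.
  have -> : (s - t) ^+ 2 / 2 = (s - t0) ^+ 2 / 2 - (t - t0) ^+ 2 / 2 - (t - t0) * (s - t).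
    by field.
  have -> : s - t = (s - t0) - (t - t0) by ring.
  move: (s - t0) (t - t0) => x y.
  by rewrite !rmorphB !rmorphM !rmorphB /=; ring.
rewrite modcM modc_real normrM normrX expr2 (@ger0_norm _ 2^-1) //.
move: sd; rewrite ltr_pdivlMr; last by lra.
have := normr_ge0 (s - t); set x := `|s - t| => x0 H.
by nra.
Qed.

End Paths.

(** * Integrals over segments and Goursat's lemma *)

Section Integral.
Variable R : realType.
Implicit Types (p : R -> R[i]) (a b c d t : R) (f : R[i] -> R[i]).

(** Only the increments of a primitive matter, so a chosen primitive serves as a
    total integral: additivity and orientation of integrals become identities
    between differences, valid for every path. *)
Definition primitive p : R -> R[i] :=
  if pselect (exists P, forall t, pderiv P t (p t)) is left h
  then sval (cid h) else fun=> 0.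

Definition integ p a b : R[i] := primitive p b - primitive p a.

Lemma pderiv0_cst p a b : (forall t, pderiv p t 0) -> p a = p b.
Proof.
wlog ab : a b / a <= b.
  move=> H p0; have [ab|/ltW ba] := leP a b; first exact: H.
  by apply/esym; exact: H.
move=> p0; apply/esym/eqP; rewrite -subr_eq0 -modc_eq0 eq_le modc_ge0 andbT.
have := @pmvt_le R p (fun=> 0) a b 0 ab; rewrite mulr0 mul0r => H.
by apply: H => t _ //; rewrite modc0.
Qed.

Lemma integE p P a b : (forall t, pderiv P t (p t)) -> integ p a b = P b - P a.
Proof.
move=> HP; rewrite /integ /primitive; case: pselect => [h|]; last by case; exists P.
case: cid => Q HQ /=.
have : (fun s => Q s - P s) a = (fun s => Q s - P s) b.
  by apply: (@pderiv0_cst (fun s => Q s - P s)) => t; have := pderivB (HQ t) (HP t); rewrite subrr.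
move=> /= H; have -> : Q b = (Q b - P b) + P b by ring.
by rewrite -H; ring.
Qed.

Lemma integ_primitive p : (forall t, pcont p t) ->
  exists2 P, forall t, pderiv P t (p t) & forall a b, integ p a b = P b - P a.
Proof.
by move=> /pprimitive_exists[P HP]; exists P => // a b; exact: integE.
Qed.

(** A path uniformly close to an affine one has an integral close to the explicit
    integral of the affine path. Goursat's lemma needs exactly this case, because
    a differentiable function is locally a small perturbation of an affine one. *)
Lemma integ_affine_le p a b (k l : R[i]) t0 M : (forall t, pcont p t) -> a <= b ->
  (forall t, a <= t <= b -> modc (p t - (k + l * (t - t0)%:C)) <= M) ->
  modc (integ p a b -
    (k * (b - a)%:C + l * (((b - t0) ^+ 2 - (a - t0) ^+ 2) / 2)%:C)) <= 2 * M * (b - a).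
Proof.
move=> /integ_primitive[P HP ->] ab H.
pose Q t := P t - (k * (t - t0)%:C + l * ((t - t0) ^+ 2 / 2)%:C).
have QD t : pderiv Q t (p t - (k + l * (t - t0)%:C)).
  by apply: pderivB => //; exact: pderiv_affine.
have := pmvt_le ab (fun t _ => QD t) H; congr (modc _ <= _).
rewrite /Q; have -> : b - a = (b - t0) - (a - t0) by ring.
move: (b - t0) (a - t0) => x y.
by rewrite mulrBl !rmorphB /=; ring.
Qed.

Lemma integ_cst_le p a b (k : R[i]) M : (forall t, pcont p t) ->
  (forall t, Num.min a b <= t <= Num.max a b -> modc (p t - k) <= M) ->
  modc (integ p a b - k * (b - a)%:C) <= 2 * M * `|b - a|.
Proof.
move=> pc H.
have K x y : x <= y -> (forall t, x <= t <= y -> modc (p t - k) <= M) ->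
    modc (integ p x y - k * (y - x)%:C) <= 2 * M * `|y - x|.
  move=> xy B; have := @integ_affine_le p x y k 0 0 M pc xy.
  rewrite mul0r addr0 ger0_norm ?subr_ge0 // => G; apply: G => t.
  by rewrite mul0r addr0; exact: B.
have [ab|/ltW ba] := leP a b.
  by apply: K => // t; move: (H t); rewrite (min_idPl ab) (max_idPr ab).
rewrite -modcN opprB distrC.
have -> : k * (b - a)%:C - integ p a b = integ p b a - k * (a - b)%:C.
  by rewrite /integ !rmorphB /=; ring.
by apply: K => // t; move: (H t); rewrite (min_idPr ba) (max_idPl ba).
Qed.

Definition hor f y : R -> R[i] := fun t => f (t +i* y).
Definition ver f x : R -> R[i] := fun s => f (x +i* s).

Lemma hor_cont f y : (forall z, ccont f z) -> forall t, pcont (hor f y) t.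
Proof.
move=> fc t e /(fc (t +i* y))[d d0 dP]; exists d => // s sd; apply: dP.
apply: le_lt_trans sd; apply: (le_trans (modc_le _)).
by rewrite !ReImE /= subrr normr0 addr0.
Qed.

Lemma ver_cont f x : (forall z, ccont f z) -> forall t, pcont (ver f x) t.
Proof.
move=> fc t e /(fc (x +i* t))[d d0 dP]; exists d => // s sd; apply: dP.
apply: le_lt_trans sd; apply: (le_trans (modc_le _)).
by rewrite !ReImE /= subrr normr0 add0r.
Qed.

(** The integral over the boundary of the rectangle with opposite corners
    [a +i* c] and [b +i* d], counterclockwise when [a <= b] and [c <= d]. *)
Definition rect_integ f a b c d : R[i] :=
  integ (hor f c) a b - integ (hor f d) a b +
  'i%C * (integ (ver f b) c d - integ (ver f a) c d).

(** The boundary integral of an affine function vanishes, so only the remainder of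
    the first order expansion at [z] contributes: it has size [e] times the
    diameter, on a boundary of length comparable to the diameter. *)
Lemma rect_local f a b c d (z l : R[i]) e : (forall z, ccont f z) ->
  a <= complex.Re z <= b -> c <= complex.Im z <= d ->
  0 <= e ->
  (forall w, a <= complex.Re w <= b -> c <= complex.Im w <= d ->
     modc (f w - f z - l * (w - z)) <= e * modc (w - z)) ->
  modc (rect_integ f a b c d) <= 4 * e * (b - a + (d - c)) ^+ 2.
Proof.
case: z => x y /= fc /andP[ax xb] /andP[cy yd] e0 H.
set D := b - a + (d - c).
have ab : a <= b by exact: le_trans xb.
have cd : c <= d by exact: le_trans yd.
have H' w : a <= complex.Re w <= b -> c <= complex.Im w <= d ->
     modc (f w - f (x +i* y) - l * (w - x +i* y)) <= e * D.
  move=> wr wi; apply: (le_trans (H w wr wi)); apply: ler_wpM2l => //.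
  apply: (le_trans (modc_le _)); rewrite !ReImE /=.
  move/andP: wr => [? ?]; move/andP: wi => [? ?].
  rewrite /D; apply: lerD; rewrite ler_norml; lra.
have hb v : c <= v <= d ->
    modc (integ (hor f v) a b - ((f (x +i* y) + l * ('i%C * (v - y)%:C)) * (b - a)%:C +
       l * (((b - x) ^+ 2 - (a - x) ^+ 2) / 2)%:C)) <= 2 * (e * D) * (b - a).
  move=> vcd; apply: integ_affine_le => //; first exact: hor_cont.
  move=> t tab; have := H' (t +i* v) tab vcd.
  rewrite /hor (complex_split t v) (complex_split x y).
  by congr (modc _ <= _); rewrite !rcB; ring.
have vb u : a <= u <= b ->
    modc (integ (ver f u) c d - ((f (x +i* y) + l * (u - x)%:C) * (d - c)%:C +
       (l * 'i%C) * (((d - y) ^+ 2 - (c - y) ^+ 2) / 2)%:C)) <= 2 * (e * D) * (d - c).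
  move=> uab; apply: integ_affine_le => //; first exact: ver_cont.
  move=> t tab; have := H' (u +i* t) uab tab.
  rewrite /ver (complex_split u t) (complex_split x y).
  by congr (modc _ <= _); rewrite !rcB; ring.
have := hb c; rewrite lexx cd => /(_ isT).
have := hb d; rewrite lexx cd => /(_ isT).
have := vb a; rewrite lexx ab => /(_ isT).
have := vb b; rewrite lexx ab => /(_ isT).
set E1 := integ _ _ _ - _; set E2 := integ _ _ _ - _.
set E3 := integ _ _ _ - _; set E4 := integ _ _ _ - _ => h1 h2 h3 h4.
have -> : rect_integ f a b c d = E4 - E3 + 'i%C * (E1 - E2).
  rewrite /rect_integ /E1 /E2 /E3 /E4.
  move: (integ _ _ _) (integ _ _ _) (integ _ _ _) (integ _ _ _) (f _) => I1 I2 I3 I4 f0.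
  rewrite !rcB.
  ring.
apply: (le_trans (modcD _ _)); rewrite modcM modc_i mul1r.
have := modcB E4 E3; have := modcB E1 E2.
have -> : 4 * e * D ^+ 2 = 2 * (2 * (e * D) * (b - a)) + 2 * (2 * (e * D) * (d - c)).
  by rewrite /D; ring.
lra.
Qed.

Lemma rect_chain f a b x y z :
  rect_integ f a b x z = rect_integ f a b x y + rect_integ f a b y z.
Proof.
rewrite /rect_integ /integ.
move: (primitive (ver f a)) (primitive (ver f b)).
move: (primitive (hor f x)) (primitive (hor f y)) (primitive (hor f z)).
by move=> *; ring.
Qed.

Lemma rect_antiv f a b c d : rect_integ f a b c d = - rect_integ f a b d c.
Proof.
rewrite /rect_integ /integ.
move: (primitive (ver f a)) (primitive (ver f b)).
move: (primitive (hor f c)) (primitive (hor f d)).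
by move=> *; ring.
Qed.

Lemma rect_antih f a b c d : rect_integ f a b c d = - rect_integ f b a c d.
Proof.
rewrite /rect_integ /integ.
move: (primitive (ver f a)) (primitive (ver f b)).
move: (primitive (hor f c)) (primitive (hor f d)).
by move=> *; ring.
Qed.

Lemma rect_split f a b c d m n : rect_integ f a b c d =
  rect_integ f a m c n + rect_integ f m b c n +
  (rect_integ f a m n d + rect_integ f m b n d).
Proof.
rewrite /rect_integ /integ.
move: (primitive (ver f a)) (primitive (ver f b)) (primitive (ver f m)).
move: (primitive (hor f c)) (primitive (hor f d)) (primitive (hor f n)).
by move=> *; ring.
Qed.

Lemma rect_quarter f a b c d m n (eta : R) :
  4 * eta <= modc (rect_integ f a b c d) ->
  [\/ eta <= modc (rect_integ f a m c n), eta <= modc (rect_integ f m b c n),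
      eta <= modc (rect_integ f a m n d) | eta <= modc (rect_integ f m b n d)].
Proof.
rewrite (rect_split _ _ _ _ _ m n).
set A := rect_integ _ _ _ _ _; set B := rect_integ _ _ _ _ _.
set C := rect_integ _ _ _ _ _; set D := rect_integ _ _ _ _ _ => H.
have := modcD (A + B) (C + D); have := modcD A B; have := modcD C D => h1 h2 h3.
have [?|?] := leP eta (modc A); first by constructor 1.
have [?|?] := leP eta (modc B); first by constructor 2.
have [?|?] := leP eta (modc C); first by constructor 3.
have [?|?] := leP eta (modc D); first by constructor 4.
lra.
Qed.

Lemma half_pow (w : R) n : w / 2 ^+ n = w / 2 ^+ n.+1 + w / 2 ^+ n.+1.
Proof. by rewrite exprS invfM mulrA -mulrDl -splitr. Qed.

Lemma pow2_unbounded (M e : R) : 0 < e -> exists n, M < e * 2 ^+ n.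
Proof.
move=> e0; exists (Num.bound (`|M| / e)).
rewrite mulrC -ltr_pdivrMr //.
apply: (@le_lt_trans _ _ (`|M| / e)); first by rewrite ler_pM2r ?invr_gt0 ?ler_norm.
apply: (@lt_trans _ _ (Num.bound (`|M| / e))%:R).
  by apply: archi_boundP; rewrite divr_ge0 // ltW.
by rewrite -natrX ltr_nat ltn_expl.
Qed.

Lemma nested_intervals (x : nat -> R) (w : R) : 0 <= w ->
  (forall n, x n <= x n.+1 /\ x n.+1 + w / 2 ^+ n.+1 <= x n + w / 2 ^+ n) ->
  exists X, forall n, x n <= X <= x n + w / 2 ^+ n.
Proof.
move=> w0 H.
have w0n n : 0 <= w / 2 ^+ n by rewrite divr_ge0 ?exprn_ge0.
have inc n k : x n <= x (n + k)%N.
  by elim: k => [|k IH]; rewrite ?addn0 // addnS (le_trans IH) // (H _).1.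
have dec n k : x (n + k)%N + w / 2 ^+ (n + k) <= x n + w / 2 ^+ n.
  by elim: k => [|k IH]; rewrite ?addn0 // addnS (le_trans (H _).2).
have cmp n m : x m <= x n + w / 2 ^+ n.
  have [mn|/ltnW nm] := leqP m n.
    by rewrite -(subnKC mn) (le_trans (inc m (n - m)%N)) // lerDl.
  by rewrite -(subnKC nm); have := dec n (m - n)%N; have := w0n (n + (m - n))%N; lra.
exists (sup (range x)) => n; apply/andP; split.
  apply: ub_le_sup; last by exists n.
  by exists (x 0%N + w / 2 ^+ 0) => _ [m _ <-]; exact: cmp.
by apply: ge_sup; [exists (x 0%N); exists 0%N|move=> _ [m _ <-]; exact: cmp].
Qed.

(** Bisection: if the boundary integral is not zero, one of the four quarters
    carries at least a quarter of it, and so on. The nested rectangles shrink to a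
    point where [f] is differentiable, and there [rect_local] makes the integral
    smaller than any fixed multiple of the area. *)
Lemma goursat f a b c d : a <= b -> c <= d -> (forall z, ccont f z) ->
  (forall z, a <= complex.Re z <= b -> c <= complex.Im z <= d ->
     exists l, cderiv f z l) ->
  rect_integ f a b c d = 0.
Proof.
move=> ab cd fc fd; apply/eqP; rewrite -modc_eq0; apply: contraT => I0.
set w := b - a; set h := d - c.
have w0 : 0 <= w by rewrite subr_ge0.
have h0 : 0 <= h by rewrite subr_ge0.
set eta := modc (rect_integ f a b c d).
have eta0 : 0 < eta by rewrite lt0r I0 modc_ge0.
pose I n (s : R * R) := modc (rect_integ f s.1 (s.1 + w / 2 ^+ n) s.2 (s.2 + h / 2 ^+ n)).
pose Q n (s s' : R * R) := eta / 4 ^+ n <= I n s ->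
   [/\ eta / 4 ^+ n.+1 <= I n.+1 s',
       s.1 <= s'.1 /\ s'.1 + w / 2 ^+ n.+1 <= s.1 + w / 2 ^+ n &
       s.2 <= s'.2 /\ s'.2 + h / 2 ^+ n.+1 <= s.2 + h / 2 ^+ n].
have wn n : 0 <= w / 2 ^+ n by rewrite divr_ge0 ?exprn_ge0.
have hn n : 0 <= h / 2 ^+ n by rewrite divr_ge0 ?exprn_ge0.
have step (ns : nat * (R * R)) : exists s', Q ns.1 ns.2 s'.
  case: ns => n [x y]; rewrite /Q /=.
  have [A|] := pselect (eta / 4 ^+ n <= I n (x, y)); last by exists (x, y).
  have A' : 4 * (eta / 4 ^+ n.+1) <= I n (x, y).
    apply: le_trans A; rewrite exprS invfM.
    by set X := (_ ^+ n)^-1; lra.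
  have B := half_pow w n; have C := half_pow h n.
  have wn1 := wn n.+1; have hn1 := hn n.+1.
  have := @rect_quarter f _ _ _ _ (x + w / 2 ^+ n.+1) (y + h / 2 ^+ n.+1) _ A'.
  rewrite /I /= => -[] D.
  - exists (x, y) => _; split => //=; split; lra.
  - exists (x + w / 2 ^+ n.+1, y) => _; split => /=; [|split; lra|split; lra].
    by rewrite -addrA -B.
  - exists (x, y + h / 2 ^+ n.+1) => _; split => /=; [|split; lra|split; lra].
    by rewrite -addrA -C.
  - exists (x + w / 2 ^+ n.+1, y + h / 2 ^+ n.+1) => _; split => /=; [|split; lra|split; lra].
    by rewrite -!addrA -B -C.
have [g gP] := choice step.
pose s := fix s n := if n is m.+1 then g (m, s m) else (a, c).
have sP n : eta / 4 ^+ n <= I n (s n).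
  elim: n => [|n IH]; last by have [] := gP (n, s n) IH.
  by rewrite /I /= !expr0 !divr1 /w /h !(addrC a) !(addrC c) !subrK.
have [X XP] : exists X, forall n, (s n).1 <= X <= (s n).1 + w / 2 ^+ n.
  by apply: nested_intervals => // n; have [] := gP (n, s n) (sP n).
have [Y YP] : exists X, forall n, (s n).2 <= X <= (s n).2 + h / 2 ^+ n.
  by apply: nested_intervals => // n; have [] := gP (n, s n) (sP n).
have [l lP] : exists l, cderiv f (X +i* Y) l.
  apply: fd => /=.
    by have := XP 0%N; rewrite /= expr0 divr1 /w addrC subrK.
  by have := YP 0%N; rewrite /= expr0 divr1 /h addrC subrK.
(* The summand 1 covers rectangles reduced to a point. *)
pose e := eta / (4 * (w + h) ^+ 2 + 1).
have e1 : 0 < 4 * (w + h) ^+ 2 + 1 by have := sqr_ge0 (w + h); lra.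
have e0 : 0 < e by rewrite divr_gt0.
have [r r0 rP] := lP e e0.
have [n nP] : exists n, (w + h) / 2 ^+ n < r.
  have [n nP] := pow2_unbounded (w + h) r0; exists n.
  by rewrite ltr_pdivrMr ?exprn_gt0.
have := @rect_local f _ _ _ _ (X +i* Y) l e fc (XP n) (YP n) (ltW e0).
have B z : (s n).1 <= complex.Re z <= (s n).1 + w / 2 ^+ n ->
    (s n).2 <= complex.Im z <= (s n).2 + h / 2 ^+ n ->
    modc (f z - f (X +i* Y) - l * (z - X +i* Y)) <= e * modc (z - X +i* Y).
  move=> zr zi; apply: rP; apply: le_lt_trans nP.
  apply: (le_trans (modc_le _)); rewrite !ReImE /= mulrDl.
  move: zr zi (XP n) (YP n) => /andP[? ?] /andP[? ?] /andP[? ?] /andP[? ?].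
  by apply: lerD; rewrite ler_norml; lra.
move=> /(_ B) /(le_trans (sP n)).
have -> : (s n).1 + w / 2 ^+ n - (s n).1 + ((s n).2 + h / 2 ^+ n - (s n).2) =
   (w + h) / 2 ^+ n by ring.
have -> : 4 * e * ((w + h) / 2 ^+ n) ^+ 2 = (e * (4 * (w + h) ^+ 2)) / 4 ^+ n.
  rewrite expr_div_n -exprM mulnC exprM.
  have -> : (2 : R) ^+ 2 = 4 by ring.
  by move: ((w + h) ^+ 2) (_ ^-1) => W V; ring.
rewrite ler_pM2r ?invr_gt0 ?exprn_gt0 //.
rewrite leNgt => /negP; case.
rewrite /e mulrAC ltr_pdivrMr // ltr_pM2l //; lra.
Qed.

End Integral.

(** * Primitives of functions differentiable off the real axis *)

Section Primitive.
Variable R : realType.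
Implicit Types (p : R -> R[i]) (a b c d t : R) (f : R[i] -> R[i]).

(** Uniformity in [t] comes from the compactness of [[a, b]]. *)
Lemma hor_unif_near_axis f a b e : (forall z, ccont f z) -> 0 < e ->
  exists2 r, 0 < r & forall y t, `|y| < r -> a <= t <= b ->
    modc (hor f y t - hor f 0 t) < e.
Proof.
move=> fc e0.
have := @segment_compact R a b; rewrite compact_near_coveringP.
move=> /(_ R (nbhs (0:R)) (fun y t => modc (hor f y t - hor f 0 t) < e)) H.
have : \forall y \near (0:R), `[a, b] `<=` (fun t => modc (hor f y t - hor f 0 t) < e).
  apply: H => x _.
  have e2 : 0 < e / 2 by rewrite divr_gt0.
  have [d d0 dP] := fc (x +i* 0) _ e2.
  have d2 : 0 < d / 2 by rewrite divr_gt0.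
  exists (ball x (d / 2), ball (0:R) (d / 2)); first by split; exact: nbhsx_ballx.
  move=> [t y] /= []; rewrite /ball /= distrC sub0r normrN => tx y0.
  have h1 : modc (hor f y t - f (x +i* 0)) < e / 2.
    by apply: dP; apply: (le_lt_trans (modc_le _)); rewrite !ReImE /= subr0; lra.
  have h2 : modc (hor f 0 t - f (x +i* 0)) < e / 2.
    by apply: dP; apply: (le_lt_trans (modc_le _)); rewrite !ReImE /= subr0 normr0; lra.
  have -> : hor f y t - hor f 0 t = (hor f y t - f (x +i* 0)) - (hor f 0 t - f (x +i* 0)).
    by ring.
  by apply: (le_lt_trans (modcB _ _)); lra.
move=> /nbhs_ballP[r /= r0 rP]; exists r => // y t yr tab.
by apply: (rP y) => /=; rewrite ?in_itv // /ball /= sub0r normrN.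
Qed.

(** As a function of the height of one side, the boundary integral is constant
    above the axis and constant below it, by Goursat's lemma; it is continuous and
    vanishes when the rectangle is flat on the axis, so it vanishes throughout. *)
Lemma goursat_off_axis f a b c d : a <= b -> c <= d -> (forall z, ccont f z) ->
  (forall z, complex.Im z != 0 -> exists l, cderiv f z l) ->
  rect_integ f a b c d = 0.
Proof.
move=> ab cd fc fd.
pose A y := rect_integ f a b y 0.
have AE x y : rect_integ f a b x y = A x - A y.
  by rewrite /A (rect_chain f a b x y 0) addrK.
have Acst x y : x <= y -> 0 < x * y -> A x = A y.
  move=> xy xy0; apply/eqP; rewrite -subr_eq0 -AE; apply/eqP.
  apply: goursat => // z _ /andP[xz zy]; apply: fd.
  by apply: contraTneq xy0 => z0; rewrite -leNgt; nra.
have A0 : A 0 = 0 by rewrite /A /rect_integ /integ; ring.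
have [P HP PE] := integ_primitive (ver_cont a fc).
have [Q HQ QE] := integ_primitive (ver_cont b fc).
have small e : 0 < e -> exists2 r, 0 < r & forall y, `|y| < r -> modc (A y) <= e.
  move=> e0.
  have e1 : 0 < e / (4 * (1 + (b - a))) by rewrite divr_gt0 //; lra.
  have e4 : 0 < e / 4 by rewrite divr_gt0.
  have [r r0 rP] := @hor_unif_near_axis f a b _ fc e1.
  have [r1 r10 rP1] := pderiv_pcont (HP 0) e4.
  have [r2 r20 rP2] := pderiv_pcont (HQ 0) e4.
  exists (Num.min r (Num.min r1 r2)); first by rewrite !lt_min r0 r10 r20.
  move=> y; rewrite !lt_min => /and3P[yr yr1 yr2].
  have h1 := rP1 y; rewrite subr0 in h1; have {}h1 := h1 yr1.
  have h2 := rP2 y; rewrite subr0 in h2; have {}h2 := h2 yr2.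
  have [U HU UE] := integ_primitive (hor_cont y fc).
  have [V HV VE] := integ_primitive (hor_cont 0 fc).
  have h3 : modc (integ (hor f y) a b - integ (hor f 0) a b) <= e / 2.
    have := @pmvt_le R (fun t => U t - V t) (fun t => hor f y t - hor f 0 t) a b (e / (4 * (1 + (b - a)))) ab.
    rewrite UE VE => H.
    have -> : U b - U a - (V b - V a) = U b - V b - (U a - V a) by ring.
    apply: (le_trans (H _ _)) => [t _|t tab|].
    - exact: pderivB.
    - by apply/ltW; exact: rP.
    - have ba : 0 < 1 + (b - a) by lra.
      have -> : 2 * (e / (4 * (1 + (b - a)))) * (b - a) = (e / 2) * ((b - a) / (1 + (b - a))).
        by field; rewrite gt_eqF.
      by rewrite ler_piMr //; [lra|rewrite ler_pdivrMr //; lra].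
  rewrite /A /rect_integ PE QE; apply: (le_trans (modcD _ _)).
  rewrite modcM modc_i mul1r.
  have -> : Q 0 - Q y - (P 0 - P y) = (P y - P 0) - (Q y - Q 0) by ring.
  have := modcB (P y - P 0) (Q y - Q 0); lra.
have Az y : A y = 0.
  have [->//|y0] := eqVneq y 0.
  apply/eqP; rewrite -modc_eq0; apply: contraT => Ay.
  have Ay0 : 0 < modc (A y) / 2 by rewrite divr_gt0 // lt0r Ay modc_ge0.
  have [r r0 rP] := small _ Ay0.
  have ny : 0 < `|y| by rewrite normr_gt0.
  pose k := Num.min 1 (r / (2 * `|y|)).
  have k0 : 0 < k by rewrite lt_min ltr01 divr_gt0 // mulr_gt0.
  have k1 : k <= 1 by rewrite ge_min lexx.
  have : modc (A (k * y)) <= modc (A y) / 2.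
    apply: rP; rewrite normrM (gtr0_norm k0).
    have : k <= r / (2 * `|y|) by rewrite ge_min lexx orbT.
    rewrite ler_pdivlMr ?mulr_gt0 //; lra.
  suff -> : A (k * y) = A y by have := modc_ge0 (A y); lra.
  have kyy : 0 < k * y * y by rewrite -mulrA -expr2 mulr_gt0 // exprn_even_gt0.
  have [H|/ltW H] := leP (k * y) y; first exact: Acst.
  by apply/esym; apply: Acst => //; rewrite mulrC.
by rewrite AE !Az subrr.
Qed.

(** The primitive is the integral along the horizontal then vertical path from
    the origin; since boundary integrals over rectangles vanish, its increment
    between nearby points is an integral over a short path between them. *)
Theorem primitive_off_axis f : (forall z, ccont f z) ->
  (forall z, complex.Im z != 0 -> exists l, cderiv f z l) ->
  exists F, forall z, cderiv F z (f z).
Proof.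
move=> fc fd.
have rect0 a b c d : rect_integ f a b c d = 0.
  have cd0 a' b' c' d' : a' <= b' -> rect_integ f a' b' c' d' = 0.
    move=> ab'; have [?|/ltW ?] := leP c' d'; first exact: goursat_off_axis.
    by rewrite rect_antiv goursat_off_axis ?oppr0.
  have [?|/ltW ?] := leP a b; first exact: cd0.
  by rewrite rect_antih cd0 ?oppr0.
exists (fun z => integ (hor f 0) 0 (complex.Re z) +
               'i%C * integ (ver f (complex.Re z)) 0 (complex.Im z)).
move=> [x y] e e0.
have e4 : 0 < e / 4 by rewrite divr_gt0.
have [r r0 rP] := fc (x +i* y) _ e4.
have r2 : 0 < r / 2 by rewrite divr_gt0.
exists (r / 2) => // -[x' y'] wr.
have wrr := le_lt_trans (ler_Re_modc _) wr.
have wri := le_lt_trans (ler_Im_modc _) wr.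
rewrite !ReImE /= in wrr wri.
change (modc (integ (hor f 0) 0 x' + 'i%C * integ (ver f x') 0 y' -
   (integ (hor f 0) 0 x + 'i%C * integ (ver f x) 0 y) -
   f (x +i* y) * (x' +i* y' - x +i* y)) <= e * modc (x' +i* y' - x +i* y)).
have -> : integ (hor f 0) 0 x' + 'i%C * integ (ver f x') 0 y' -
   (integ (hor f 0) 0 x + 'i%C * integ (ver f x) 0 y) -
   f (x +i* y) * (x' +i* y' - x +i* y) =
   (integ (hor f y) x x' - f (x +i* y) * (x' - x)%:C) +
   'i%C * (integ (ver f x') y y' - f (x +i* y) * (y' - y)%:C).
  have := rect0 x x' 0 y; rewrite /rect_integ /integ (complex_split x' y') (complex_split x y) !rcB => H.
  rewrite -[LHS]addr0 -[X in _ + X = _]oppr0 -H.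
  move: (primitive (ver f x)) (primitive (ver f x')) (primitive (hor f y)) (primitive (hor f 0)).
  move: (f _) => f0.
  by move=> *; ring.
have hb : modc (integ (hor f y) x x' - f (x +i* y) * (x' - x)%:C) <= 2 * (e / 4) * `|x' - x|.
  apply: integ_cst_le; first exact: hor_cont.
  move=> t /andP[t1 t2]; apply/ltW/rP; apply: (le_lt_trans (modc_le _)).
  rewrite !ReImE /= subrr normr0 addr0.
  suff : `|t - x| <= `|x' - x| by lra.
  move: t1 t2; case: (leP x x') => xx t1 t2; first by rewrite !ger0_norm; lra.
  by rewrite !ler0_norm; lra.
have vb : modc (integ (ver f x') y y' - f (x +i* y) * (y' - y)%:C) <= 2 * (e / 4) * `|y' - y|.
  apply: integ_cst_le; first exact: ver_cont.
  move=> t /andP[t1 t2]; apply/ltW/rP; apply: (le_lt_trans (modc_le _)).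
  rewrite !ReImE /=.
  suff : `|t - y| <= `|y' - y| by lra.
  move: t1 t2; case: (leP y y') => xx t1 t2; first by rewrite !ger0_norm; lra.
  by rewrite !ler0_norm; lra.
apply: (le_trans (modcD _ _)); rewrite modcM modc_i mul1r.
have := ler_Re_modc (x' +i* y' - x +i* y); have := ler_Im_modc (x' +i* y' - x +i* y).
rewrite !ReImE /=.
move: (`|x' - x|) (`|y' - y|) (modc _) (modc _) (modc _) hb vb => u v m1 m2 m3.
nra.
Qed.

End Primitive.

(** * Maximum modulus *)

Section MaximumPrinciple.
Variable R : realType.
Implicit Types (f g F G : R[i] -> R[i]) (z w : R[i]).

(** The sup norm: its balls are products of segments, whose compactness is
    immediate, and horizontal and vertical steps stay inside them. *)
Definition supc z : R := Num.max `|complex.Re z| `|complex.Im z|.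

Lemma supc_le z (r : R) : (supc z <= r) = (`|complex.Re z| <= r) && (`|complex.Im z| <= r).
Proof. by rewrite /supc ge_max. Qed.

Lemma supc_modc z : supc z <= modc z.
Proof. by rewrite supc_le ler_Re_modc ler_Im_modc. Qed.

Lemma modc_supc z : modc z <= 2 * supc z.
Proof.
apply: (le_trans (modc_le z)).
have : supc z <= supc z by []; rewrite supc_le => /andP[? ?]; lra.
Qed.

Lemma supcD z w : supc (z + w) <= supc z + supc w.
Proof.
have : supc z <= supc z by []; rewrite supc_le => /andP[? ?].
have : supc w <= supc w by []; rewrite supc_le => /andP[? ?].
rewrite supc_le !ReImE; apply/andP; split; apply: (le_trans (ler_normD _ _)); lra.
Qed.

Lemma supc_real (x : R) : supc x%:C = `|x|.
Proof. by rewrite /supc /= normr0; apply/max_idPl. Qed.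

Lemma supc_shift z (s : R) : `|supc (z + s%:C) - supc z| <= `|s|.
Proof.
rewrite -(supc_real s) ler_distl; apply/andP; split; last exact: supcD.
have := supcD (z + s%:C) (- s%:C); rewrite addrK.
have -> : supc (- s%:C) = supc s%:C by rewrite -rmorphN /= !supc_real normrN.
by lra.
Qed.

(** A second order substitute for the mean value property. The derivative of the
    sum along [t] is the sum of [k * F (z + k t)] over the fourth roots of unity
    [k]; both the sum of the [k] and the sum of the [k ^ 2] vanish, so the constant
    and linear terms of [F] cancel. *)
Lemma second_difference_small (G F : R[i] -> R[i]) z l : (forall w, cderiv G w (F w)) -> cderiv F z l ->
  forall e, 0 < e -> exists2 d, 0 < d & forall t, 0 < t -> t < d ->
  modc (G (z + t%:C) + G (z - t%:C) + (G (z + 'i%C * t%:C) + G (z - 'i%C * t%:C))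
        - 4 * G z) <= e * t ^+ 2.
Proof.
move=> GF Fl e e0; have e8 : 0 < e / 8 by rewrite divr_gt0.
have [d d0 dP] := Fl _ e8; exists d => // t t0 td.
pose L (k : R[i]) s := G (z + k * s%:C).
have LD k s : pderiv (L k) s (F (z + k * s%:C) * k) by apply: cderiv_line.
pose phi s := L 1 s + L (-1) s + (L 'i%C s + L (- 'i%C) s).
have phiD s := pderivD (pderivD (LD 1 s) (LD (-1) s)) (pderivD (LD 'i%C s) (LD (- 'i%C) s)).
have ii : 'i%C * 'i%C = -1 :> R[i] by rewrite -expr2 sqr_i.
have Fk (k : R[i]) s : modc k = 1 -> 0 <= s <= t ->
    modc (F (z + k * s%:C) * k - F z * k - l * (k * k) * s%:C) <= (e / 8) * t.
  move=> k1 /andP[s0 st].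
  have E : modc (z + k * s%:C - z) = s.
    have -> : z + k * s%:C - z = k * s%:C by ring.
    by rewrite modcM k1 mul1r modc_real ger0_norm.
  have := dP (z + k * s%:C); rewrite E => /(_ (le_lt_trans st td)) H.
  have -> : F (z + k * s%:C) * k - F z * k - l * (k * k) * s%:C =
     k * (F (z + k * s%:C) - F z - l * (z + k * s%:C - z)) by ring.
  by rewrite modcM k1 mul1r (le_trans H) // ler_wpM2l // ltW.
have := @pmvt_le R phi _ 0 t ((e / 2) * t) (ltW t0) (fun s _ => phiD s).
rewrite subr0 => H.
have -> : e * t ^+ 2 = 2 * (e / 2 * t) * t by field.
have -> : G (z + t%:C) + G (z - t%:C) + (G (z + 'i%C * t%:C) + G (z - 'i%C * t%:C))
        - 4 * G z = phi t - phi 0.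
  rewrite /phi /L !mulr0 !addr0 mul1r mulN1r mulNr; ring.
apply: H => s st.
have h1 := Fk 1 s (modc1 R) st.
have h2 := Fk (-1) s; rewrite modcN modc1 in h2; have {}h2 := h2 erefl st.
have h3 := Fk 'i%C s (modc_i R) st.
have h4 := Fk (- 'i%C) s; rewrite modcN modc_i in h4; have {}h4 := h4 erefl st.
rewrite ii in h3; rewrite mulrNN ii in h4; rewrite mulrNN mulr1 in h2.
rewrite !mulr1 in h1.
move: h1 h2 h3 h4; set A := F _ - _ - _; set B := F _ * -1 - _ - _.
set C := F _ * _ - _ - _; set D := F _ * - 'i%C - _ - _ => h1 h2 h3 h4.
rewrite !mulr1.
have -> : F (z + 1 * s%:C) + F (z + -1 * s%:C) * -1 +
   (F (z + 'i%C * s%:C) * 'i%C + F (z + - 'i%C * s%:C) * - 'i%C) = A + B + (C + D).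
  rewrite /A /B /C /D; ring.
have := modcD (A + B) (C + D); have := modcD A B; have := modcD C D.
lra.
Qed.

Lemma pair_continuous f : (forall z, ccont f z) ->
  continuous (fun p : R * R => modc (f (p.1 +i* p.2))).
Proof.
move=> fc [x y]; apply/cvgrPdist_lt => e e0.
have [d d0 dP] := fc (x +i* y) e e0.
have d2 : 0 < d / 2 by rewrite divr_gt0.
exists (ball x (d / 2), ball y (d / 2)); first by split; exact: nbhsx_ballx.
move=> [x' y'] /= []; rewrite /ball /= => hx hy.
have H : modc (f (x' +i* y') - f (x +i* y)) < e.
  apply: dP; apply: (le_lt_trans (modc_le _)); rewrite !ReImE /=.
  by rewrite (distrC x') (distrC y'); lra.
apply: le_lt_trans H; rewrite ler_norml.
have := modc_sum_lb (f (x +i* y)) (f (x' +i* y') - f (x +i* y)).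
have := modc_sum_lb (f (x' +i* y')) (- (f (x' +i* y') - f (x +i* y))).
rewrite modcN.
have -> : f (x +i* y) + (f (x' +i* y') - f (x +i* y)) = f (x' +i* y') by ring.
have -> : f (x' +i* y') + - (f (x' +i* y') - f (x +i* y)) = f (x +i* y) by ring.
lra.
Qed.

Lemma square_bounded f r : (forall z, ccont f z) ->
  exists M, forall z, supc z <= r -> modc (f z) <= M.
Proof.
move=> fc; have [r0|r0] := ltP r 0.
  exists 0 => z; rewrite supc_le => /andP[H _]; have := normr_ge0 (complex.Re z); lra.
have cK : compact (`[- r, r]%classic `*` `[- r, r]%classic : set (R * R)).
  by apply: compact_setX; exact: segment_compact.
have K0 : (`[- r, r]%classic `*` `[- r, r]%classic : set (R * R)) !=set0.
  by exists (0, 0); split; rewrite /= in_itv /= oppr_le0 r0.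
have [|c cK' cmax] := compact_EVT_max (f := fun p : R * R => modc (f (p.1 +i* p.2))) K0 cK.
  by apply: continuous_subspaceT; exact: pair_continuous.
exists (modc (f (c.1 +i* c.2))) => -[x y]; rewrite supc_le /= => /andP[hx hy].
by apply: (cmax (x, y)); rewrite inE; split; rewrite /= in_itv /= -ler_norml.
Qed.

(** At an interior maximum [c] of [modc (G z) + e * modc z ^ 2] the average over
    the four points [c + t k] would exceed the value at [c] by [e * t ^ 2], up to
    the smaller error of [second_difference_small]. *)
Lemma max_square (G F f : R[i] -> R[i]) r M : 0 < r ->
  (forall w, cderiv G w (F w)) -> (forall w, cderiv F w (f w)) ->
  (forall w, supc w = r -> modc (G w) <= M) ->
  forall z, supc z <= r -> modc (G z) <= M.
Proof.
move=> r0 GF Ff HM z1 z1r; rewrite leNgt; apply/negP => GM.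
(* On the square [modc (z * z) <= 4 * r ^ 2], so the perturbation stays below half
   of the excess [modc (G z1) - M]. *)
pose e := (modc (G z1) - M) / (8 * r ^+ 2).
have r2 : 0 < 8 * r ^+ 2 by rewrite mulr_gt0 // exprn_gt0.
have e0 : 0 < e by rewrite divr_gt0 // subr_gt0.
have eE : e * (8 * r ^+ 2) = modc (G z1) - M by rewrite /e divfK // gt_eqF.
have Gc z : ccont G z by apply: cderiv_ccont (GF z).
have sc z : ccont (fun w => w * w) z.
  by apply: cderiv_ccont (cderivM (cderiv_id z) (cderiv_id z)).
pose u z := modc (G z) + e * modc (z * z).
have cK : compact (`[- r, r]%classic `*` `[- r, r]%classic : set (R * R)).
  by apply: compact_setX; exact: segment_compact.
have K0 : (`[- r, r]%classic `*` `[- r, r]%classic : set (R * R)) !=set0.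
  by exists (0, 0); split; rewrite /= in_itv /= oppr_le0 ltW.
have [|[cx cy] cK' cmax] := compact_EVT_max (f := fun p : R * R => u (p.1 +i* p.2)) K0 cK.
  apply: continuous_subspaceT => p; apply: cvgD; first exact: (pair_continuous Gc).
  by apply: cvgM; [exact: cvg_cst|exact: (pair_continuous sc)].
have umax z : supc z <= r -> u z <= u (cx +i* cy).
  case: z => x y; rewrite supc_le /= => /andP[hx hy].
  by apply: (cmax (x, y)); rewrite inE; split; rewrite /= in_itv /= -ler_norml.
have cr : supc (cx +i* cy) <= r.
  move: cK'; rewrite inE => -[]; rewrite /= !in_itv /= -!ler_norml => h1 h2.
  by rewrite supc_le /= h1.
have m0 : 0 <= modc (z1 * z1) by exact: modc_ge0.
(* The maximum is not attained on the boundary, where [modc (G w) <= M]. *)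
have cltr : supc (cx +i* cy) < r.
  rewrite lt_neqAle cr andbT; apply/negP => /eqP cE.
  have := umax _ z1r; have := HM _ cE; rewrite /u.
  have := modc_supc (cx +i* cy); rewrite cE !modcM => h1 h2 h3.
  have := modc_ge0 (cx +i* cy); move: h1 h2 h3; set c := modc (_ +i* _) => h1 h2 h3 c0.
  have cc : c * c <= 4 * r ^+ 2 by nra.
  have ecc : e * (c * c) <= e * (4 * r ^+ 2) by rewrite ler_pM2l.
  have em : 0 <= e * (modc z1 * modc z1) by rewrite -modcM mulr_ge0 // ltW.
  have : 0 < e * (4 * r ^+ 2) by rewrite mulr_gt0 // mulr_gt0 // exprn_gt0.
  lra.
move: umax cltr; set c := (cx +i* cy)%C => umax cltr.
have e1 : 0 < e by [].
have [d d0 dP] := second_difference_small GF (Ff c) e1.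
pose t := Num.min (d / 2) (r - supc c).
have t0 : 0 < t by rewrite lt_min divr_gt0 //= subr_gt0.
have td : t < d by rewrite gt_min; apply/orP; left; lra.
have tr : t <= r - supc c by rewrite ge_min lexx orbT.
have := dP t t0 td.
have it : supc ('i%C * t%:C) = t.
  rewrite /supc !ReImE /= !mul0r !mulr0 mul1r subrr add0r.
  by rewrite normr0 (gtr0_norm t0); apply/max_idPr/ltW.
have rt : supc t%:C = t by rewrite supc_real gtr0_norm.
have supN w : supc (- w) = supc w by rewrite /supc !ReImE !normrN.
have U w : supc w = t -> u (c + w) <= u c.
  by move=> wt; apply: umax; have := supcD c w; rewrite wt; lra.
have := U _ rt; have := U (- t%:C); rewrite supN => /(_ rt).
have := U _ it; have := U (- ('i%C * t%:C)); rewrite supN => /(_ it).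
rewrite /u => u1 u2 u3 u4 H.
(* The mean of [modc w ^ 2] over the four points is [modc c ^ 2 + t ^ 2]. *)
have S : modc ((c - 'i%C * t%:C) * (c - 'i%C * t%:C)) + modc ((c + 'i%C * t%:C) * (c + 'i%C * t%:C))
   + (modc ((c - t%:C) * (c - t%:C)) + modc ((c + t%:C) * (c + t%:C))) = 4 * modc (c * c) + 4 * t ^+ 2.
  rewrite !modcM -!expr2 !modc_sqr !ReImE /=; ring.
move: u1 u2 u3 u4 S.
set S1 := modc ((c - 'i%C * t%:C) * _); set S2 := modc ((c + 'i%C * t%:C) * _).
set S3 := modc ((c - t%:C) * _); set S4 := modc ((c + t%:C) * _) => u1 u2 u3 u4 S.
have e_S := congr1 (fun x => e * x) S.
rewrite /= !mulrDr in e_S.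
have h4 : modc (4 * G c) = 4 * modc (G c).
  by rewrite modcM; congr (_ * _); have := modc_real (4 : R); rewrite rmorph_nat ger0_norm.
have := modc_sum_lb (4 * G c) (G (c + t%:C) + G (c - t%:C) + (G (c + 'i%C * t%:C) + G (c - 'i%C * t%:C))
        - 4 * G c).
rewrite [4 * G c + _]addrC subrK h4.
have := modcD (G (c + t%:C) + G (c - t%:C)) (G (c + 'i%C * t%:C) + G (c - 'i%C * t%:C)).
have := modcD (G (c + t%:C)) (G (c - t%:C)).
have := modcD (G (c + 'i%C * t%:C)) (G (c - 'i%C * t%:C)).
have et : 0 < e * t ^+ 2 by rewrite mulr_gt0 // exprn_gt0.
lra.
Qed.

Lemma increment_le (F f : R[i] -> R[i]) z t M : 0 <= t -> (forall w, cderiv F w (f w)) ->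
  (forall s, 0 <= s <= t -> modc (f (z + s%:C)) <= M) ->
  modc (F (z + t%:C) - F z) <= 2 * M * t.
Proof.
move=> t0 Ff H.
have := @pmvt_le R (fun s => F (z + 1 * s%:C)) _ 0 t M t0 (fun s _ => cderiv_line (Ff _)).
rewrite subr0 mulr0 addr0 mul1r => K; apply: K => s st.
by rewrite mulr1 mul1r; exact: H.
Qed.

Lemma derivative_le (F : R[i] -> R[i]) z l M r : 0 < r -> cderiv F z l ->
  (forall t, 0 < t -> t < r -> modc (F (z + t%:C) - F z) <= M * t) -> modc l <= M.
Proof.
move=> r0 Fl H; apply/ler_addgt0Pr => e e0.
have [d d0 dP] := Fl e e0.
pose t := Num.min (d / 2) (r / 2).
have t0 : 0 < t by rewrite lt_min !divr_gt0.
have td : t < d by rewrite gt_min; apply/orP; left; lra.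
have tr : t < r by rewrite gt_min; apply/orP; right; lra.
have := dP (z + t%:C); have -> : z + t%:C - z = t%:C by ring.
rewrite modc_real (gtr0_norm t0) => /(_ td) A; have B := H t t0 tr.
have := modcB (F (z + t%:C) - F z) (F (z + t%:C) - F z - l * t%:C).
rewrite opprB addrC subrK modcM modc_real (gtr0_norm t0) => C.
by rewrite -(ler_pM2r t0) mulrDl; lra.
Qed.

(** The difference quotients of [G] satisfy [max_square] and converge to [F]. On
    the boundary of the square of size [2 r] they are at most [2 M], by the mean
    value inequality and the bound on the annulus; this passes to the limit. *)
Lemma maxmod_step (G F f : R[i] -> R[i]) r M : 0 < r ->
  (forall w, cderiv G w (F w)) -> (forall w, cderiv F w (f w)) ->
  (forall w, r <= supc w <= 3 * r -> modc (F w) <= M) ->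
  forall z, supc z <= 2 * r -> modc (F z) <= 2 * M.
Proof.
move=> r0 GF Ff HM z zr.
apply: (derivative_le r0 (GF z)) => t t0 tr.
have := @max_square (fun w => G (w + t%:C) - G w) (fun w => F (w + t%:C) - F w)
  (fun w => f (w + t%:C) - f w) (2 * r) (2 * M * t).
apply => //; first by rewrite mulr_gt0.
- by move=> w; apply: cderivD; [exact: cderiv_shift|exact: cderivN].
- by move=> w; apply: cderivD; [exact: cderiv_shift|exact: cderivN].
move=> w wr; apply: increment_le => [||s /andP[s0 st]]; [exact: ltW|exact: GF|].
apply: HM; have := supc_shift w s; rewrite (ger0_norm s0) ler_norml; lra.
Qed.

(** A weak form of the maximum modulus principle, with a constant 4 and an annulus
    in place of the boundary. It follows from two descents [maxmod_step] along
    [G' = F] and [F' = f]: the existence of two primitives replaces the smoothness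
    of [f]. *)
Theorem maximum_modulus f r M : 0 < r -> (forall z, ccont f z) ->
  (forall z, complex.Im z != 0 -> exists l, cderiv f z l) ->
  (forall w, r <= supc w <= 7 * r -> modc (f w) <= M) ->
  forall z, supc z <= r -> modc (f z) <= 4 * M.
Proof.
move=> r0 fc fd HM z zr.
have [F Ff] := primitive_off_axis fc fd.
have [G GF] : exists G, forall z, cderiv G z (F z).
  by apply: primitive_off_axis => w; [exact: cderiv_ccont (Ff w)|exists (f w)].
apply: (derivative_le r0 (Ff z)) => t t0 tr.
have -> : 4 * M * t = 2 * (2 * M * t) by ring.
apply: (@maxmod_step (fun w => G (w + t%:C) - G w) (fun w => F (w + t%:C) - F w)
  (fun w => f (w + t%:C) - f w) (2 * r)); last by lra.
- by rewrite mulr_gt0.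
- by move=> w; apply: cderivD; [exact: cderiv_shift|exact: cderivN].
- by move=> w; apply: cderivD; [exact: cderiv_shift|exact: cderivN].
move=> w wr; apply: increment_le => [||s /andP[s0 st]]; [exact: ltW|exact: Ff|].
apply: HM; have := supc_shift w s; rewrite (ger0_norm s0) ler_norml; lra.
Qed.

End MaximumPrinciple.

(** * Identity theorem *)

Section Identity.
Variable R : realType.
Implicit Types (f g h : R[i] -> R[i]) (z w : R[i]) (xs : seq R).

Lemma ccontM f g z : ccont f z -> ccont g z -> ccont (fun w => f w * g w) z.
Proof.
move=> fc gc e e0; have mf := modc_ge0 (f z); have mg := modc_ge0 (g z).
have ef : 0 < e / (2 * (1 + modc (g z))) by rewrite divr_gt0 // mulr_gt0; lra.
have eg : 0 < e / (2 * (1 + modc (f z))) by rewrite divr_gt0 // mulr_gt0; lra.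
have [d1 d10 H1] := fc _ ef; have [d2 d20 H2] := gc _ eg; have [d3 d30 H3] := gc _ ltr01.
exists (Num.min d1 (Num.min d2 d3)); first by rewrite !lt_min d10 d20.
move=> w; rewrite !lt_min => /and3P[/H1 + /H2 + /H3].
rewrite !ltr_pdivlMr ?mulr_gt0 //; try lra.
have -> : f w * g w - f z * g z =
    (f w - f z) * (g z + (g w - g z)) + f z * (g w - g z) by ring.
have := modcD ((f w - f z) * (g z + (g w - g z))) (f z * (g w - g z)).
have := modcD (g z) (g w - g z); rewrite !modcM.
have := modc_ge0 (f w - f z); have := modc_ge0 (g w - g z).
move: (modc (f w - f z)) (modc (g w - g z)) (modc (g z + _)) (modc (_ + _)).
by move=> a b c u b0 a0 hc hu ha hb hb1; nra.
Qed.

Lemma eq_ccont f g z (r : R) : 0 < r -> (forall w, modc (w - z) < r -> f w = g w) ->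
  ccont f z -> ccont g z.
Proof.
move=> r0 fg H e /H[d d0 dP]; exists (Num.min d r); first by rewrite lt_min d0.
move=> w; rewrite lt_min => /andP[wd wr].
by rewrite -!fg ?subrr ?modc0 //; exact: dP.
Qed.

Lemma cderiv_subV z w : z != w -> exists l, cderiv (fun u => (u - w)^-1) z l.
Proof.
move=> zw; have : z - w != 0 by rewrite subr_eq0.
by move=> /cderivV[l H]; exists l; exact: (@cderiv_shift _ _ _ _ (- w)).
Qed.

Lemma divide_zero h z0 l : (forall z, ccont h z) -> h z0 = 0 -> cderiv h z0 l ->
  exists g, [/\ forall z, ccont g z,
    forall z, z != z0 -> (exists m, cderiv h z m) -> exists m, cderiv g z m &
    forall z, h z = g z * (z - z0)].
Proof.
move=> hc h0 hl; pose g z := if z == z0 then l else h z * (z - z0)^-1.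
have gE z : z != z0 -> forall w, modc (w - z) < modc (z - z0) ->
    h w * (w - z0)^-1 = g w.
  move=> zz0 w wz; rewrite /g; case: eqP => // wE.
  by move: wz; rewrite wE modcC ltxx.
have m0 z : z != z0 -> 0 < modc (z - z0) by rewrite modc_gt0 subr_eq0.
exists g; split.
- move=> z; have [->|zz0] := eqVneq z z0.
    move=> e e0; have e2 : 0 < e / 2 by rewrite divr_gt0.
    have [d d0 dP] := hl _ e2; exists d => // w wd.
    rewrite /g eqxx; case: eqP => [_|/eqP wz]; first by rewrite subrr modc0.
    have := dP w wd; rewrite h0 subr0 => H.
    rewrite -(ltr_pM2r (m0 _ wz)) -modcM mulrBl mulfVK ?subr_eq0 //.
    apply: (le_lt_trans H); rewrite ltr_pM2r ?m0 //; lra.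
  apply: (@eq_ccont (fun w => h w * (w - z0)^-1) _ _ (modc (z - z0))); first exact: m0.
    exact: gE.
  apply: ccontM => //; have [m mP] := cderiv_subV zz0.
  exact: cderiv_ccont mP.
- move=> z zz0 [m mP]; have [k kP] := cderiv_subV zz0.
  eexists; apply: (@eq_cderiv _ (fun w => h w * (w - z0)^-1) _ _ _ (modc (z - z0))).
  + exact: m0.
  + exact: gE.
  + exact: cderivM mP kP.
- move=> z; rewrite /g; case: eqP => [->|/eqP zz0].
    by rewrite subrr mulr0 h0.
  by rewrite mulfVK // subr_eq0.
Qed.

(** Dividing by a zero preserves continuity but leaves differentiability unknown
    at that zero; as the zeros are real, the quotient still falls under
    [maximum_modulus]. *)
Lemma divide_zeros f xs : (forall z, exists l, cderiv f z l) -> uniq xs ->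
  (forall x, x \in xs -> f x%:C = 0) ->
  exists h, [/\ forall z, ccont h z,
    forall z, (forall x, x \in xs -> z != x%:C) -> exists l, cderiv h z l &
    forall z, f z = h z * \prod_(x <- xs) (z - x%:C)].
Proof.
move=> fd; elim: xs => [_ _|x xs IH].
  exists f; split => [z|z _|z]; last 1 first.
  - by rewrite big_nil mulr1.
  - by have [l H] := fd z; exact: cderiv_ccont H.
  - exact: fd.
rewrite cons_uniq => /andP[xxs uxs] f0.
have [|h [hc hd hE]] := IH uxs; first by move=> y yxs; rewrite f0 // inE yxs orbT.
have xne y : y \in xs -> x%:C != y%:C.
  by move=> yxs; apply: contraNneq xxs => /complexI ->.
have [l hl] := hd x%:C xne.
have P0 : \prod_(y <- xs) (x%:C - y%:C) != 0.
  by rewrite prodf_seq_neq0; apply/allP => y yxs; rewrite subr_eq0 xne.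
have h0 : h x%:C = 0.
  have := f0 x (mem_head _ _); rewrite hE => /eqP; rewrite mulf_eq0.
  by rewrite (negbTE P0) orbF => /eqP.
have [g [gc gd gE]] := divide_zero hc h0 hl.
exists g; split => //.
- move=> z zx; apply: gd; first by rewrite zx ?mem_head.
  by apply: hd => y yxs; rewrite zx // inE yxs orbT.
- by move=> z; rewrite big_cons hE gE mulrA.
Qed.

Lemma modc_prod_ge xs w c : 0 <= c -> (forall x, x \in xs -> c <= modc (w - x%:C)) ->
  c ^+ size xs <= modc (\prod_(x <- xs) (w - x%:C)).
Proof.
move=> c0; elim: xs => [|x xs IH] H; first by rewrite big_nil modc1.
rewrite big_cons modcM exprS; apply: ler_pM => //; rewrite ?exprn_ge0 //.
  by rewrite H ?mem_head.
by apply: IH => y yxs; rewrite H // inE yxs orbT.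
Qed.

Lemma modc_prod_le xs w c : (forall x, x \in xs -> modc (w - x%:C) <= c) ->
  modc (\prod_(x <- xs) (w - x%:C)) <= c ^+ size xs.
Proof.
elim: xs => [|x xs IH] H; first by rewrite big_nil modc1.
rewrite big_cons modcM exprS; apply: ler_pM; rewrite ?modc_ge0 //.
  by rewrite H ?mem_head.
by apply: IH => y yxs; rewrite H // inE yxs orbT.
Qed.

Lemma distinct_points_near0 (P : R -> Prop) n :
  (forall d, 0 < d -> exists x, [/\ x != 0, `|x| < d & P x]) ->
  forall d, 0 < d ->
  exists xs, [/\ uniq xs, size xs = n & forall x, x \in xs -> `|x| < d /\ P x].
Proof.
move=> H; elim: n => [|n IH] d d0; first by exists [::].
have [x [x0 xd Px]] := H d d0.
have [|xs [uxs sxs xsP]] := IH `|x|; first by rewrite normr_gt0.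
exists (x :: xs); split.
- rewrite /= uxs andbT; apply/negP => /xsP[]; by rewrite ltxx.
- by rewrite /= sxs.
- move=> y; rewrite inE => /orP[/eqP ->//|/xsP[yx Py]]; split => //.
  exact: lt_trans xd.
Qed.

(** Divide [f] by [n] real zeros close to the origin. On a large annulus every
    factor [w - x] has modulus at least [2 rho], while at [z] it is at most [rho];
    [maximum_modulus] applied to the quotient bounds [f z] by [4 M / 2 ^ n] for
    every [n]. *)
Lemma identity_at_origin f : (forall z, exists l, cderiv f z l) ->
  (forall d : R, 0 < d -> exists x, [/\ x != 0, `|x| < d & f x%:C = 0]) ->
  forall z, f z = 0.
Proof.
move=> fd acc z; apply/eqP; rewrite -modc_eq0; apply: contraT => fz.
have fz0 : 0 < modc (f z) by rewrite lt0r fz modc_ge0.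
have fc w : ccont f w by have [l H] := fd w; exact: cderiv_ccont H.
pose rho := modc z + 1; have m0 := modc_ge0 z.
have rho0 : 0 < rho by rewrite /rho; lra.
have [M HM] := square_bounded (7 * (4 * rho)) fc.
have [n nP] := pow2_unbounded (4 * M) fz0.
have [xs [uxs sxs xsP]] := @distinct_points_near0 (fun x => f x%:C = 0) n acc 1 ltr01.
have [h [hc hd hE]] := divide_zeros fd uxs (fun x xx => (xsP x xx).2).
have hz : modc (h z) <= 4 * (M / (2 * rho) ^+ n).
  apply: (@maximum_modulus R h (4 * rho)) => //.
  - by rewrite mulr_gt0.
  - move=> w w0; apply: hd => x _; apply: contraNneq w0 => ->; by rewrite /=.
  - move=> w /andP[w1 w2].
    rewrite ler_pdivlMr ?exprn_gt0 ?mulr_gt0 //.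
    apply: le_trans (HM w w2); rewrite hE modcM ler_wpM2l ?modc_ge0 // -sxs.
    apply: modc_prod_ge; first by rewrite mulr_ge0 // ltW.
    move=> x /xsP[x1 _].
    have := modc_sum_lb w (- x%:C); rewrite modcN modc_real.
    have := supc_modc w; move: w1; rewrite /rho; lra.
  - by apply: (le_trans (supc_modc _)); rewrite /rho; lra.
have : modc (f z) <= 4 * (M / (2 * rho) ^+ n) * rho ^+ n.
  rewrite hE modcM; apply: ler_pM; rewrite ?modc_ge0 // -sxs.
  apply: modc_prod_le => x /xsP[x1 _].
  by apply: (le_trans (modcB _ _)); rewrite modc_real /rho; lra.
have -> : 4 * (M / (2 * rho) ^+ n) * rho ^+ n = 4 * M / 2 ^+ n.
  have r1 : rho ^+ n != 0 by rewrite expf_neq0 // gt_eqF.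
  by rewrite exprMn invfM mulrA -!mulrA mulVf // mulr1 !mulrA.
by rewrite ler_pdivlMr ?exprn_gt0 // leNgt nP.
Qed.

Theorem identity_theorem f (x0 : R) : (forall z, exists l, cderiv f z l) ->
  (forall d : R, 0 < d -> exists x, [/\ x != x0, `|x - x0| < d & f x%:C = 0]) ->
  forall z, f z = 0.
Proof.
move=> fd acc z; rewrite -[z](subrK x0%:C).
apply: (@identity_at_origin (fun w => f (w + x0%:C))).
  by move=> w; have [l H] := fd (w + x0%:C); exists l; exact: cderiv_shift.
move=> d /acc[x [xx0 xd fx]]; exists (x - x0); split => //.
  by rewrite subr_eq0.
by rewrite rcB subrK.
Qed.

End Identity.

(** * Fixed points of a linear fractional transformation *)

Section FixedPoints.
Variable R : realType.
Implicit Types (A : 'M[R[i]]_2) (z w : R[i]).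

Lemma trace2 (K : nzRingType) (A : 'M[K]_2) : \tr A = A 0 0 + A 1 1.
Proof.
by rewrite /mxtrace !big_ord_recl big_ord0 addr0; congr (_ + A _ _); apply: val_inj.
Qed.

Lemma det2 (K : comNzRingType) (A : 'M[K]_2) : \det A = A 0 0 * A 1 1 - A 0 1 * A 1 0.
Proof.
rewrite (expand_det_row _ 0) !big_ord_recl big_ord0 addr0 /cofactor !det_mx11.
rewrite !mxE /= !expr0 !expr1 !mul1r mulN1r mulrN.
by congr (A _ _ * A _ _ - A _ _ * A _ _); apply: val_inj.
Qed.

Lemma mx2P (K : Type) (A B : 'M[K]_2) : A 0 0 = B 0 0 -> A 0 1 = B 0 1 ->
  A 1 0 = B 1 0 -> A 1 1 = B 1 1 -> A = B.
Proof.
move=> h1 h2 h3 h4; apply/matrixP => i j.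
have C (k : 'I_2) : k = 0 \/ k = 1.
  by case: k => -[|[|//]] H; [left|right]; apply: val_inj.
by case: (C i) => ->; case: (C j) => ->.
Qed.

Lemma lft_fixed A w : w != 0 -> w = lft A w ->
  A 1 0 * w ^+ 2 + (A 1 1 - A 0 0) * w - A 0 1 = 0.
Proof.
rewrite /lft => w0 E.
have den : A 1 0 * w + A 1 1 != 0.
  by apply: contraNneq w0 => d0; rewrite E d0 invr0 mulr0.
have : w * (A 1 0 * w + A 1 1) = A 0 0 * w + A 0 1 by rewrite {1}E mulfVK.
move=> H; have -> : A 1 0 * w ^+ 2 + (A 1 1 - A 0 0) * w - A 0 1 =
   w * (A 1 0 * w + A 1 1) - (A 0 0 * w + A 0 1) by ring.
by rewrite H subrr.
Qed.

Lemma Im_neq0 z : upper_half_plane z -> z != 0.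
Proof. by rewrite /upper_half_plane => z0; apply: contraTneq z0 => ->; rewrite ltxx. Qed.

(** The discriminant of the fixed point equation of [A] when [\det A = 1]. *)
Definition disc A : R[i] := \tr A ^+ 2 - 4.

(** [p] and [- q] lie in opposite half-planes, hence are the two distinct roots of
    the quadratic equation [A 1 0 w^2 + (A 1 1 - A 0 0) w - A 0 1 = 0]; the
    conclusions are Vieta's formulas and the discriminant as squared difference of
    the roots. *)
Lemma two_fixed_points A p q : upper_half_plane p -> upper_half_plane q ->
  \det A = 1 -> p = lft A p -> - q = lft A (- q) ->
  [/\ A 1 0 * (p - q) = A 0 0 - A 1 1, A 1 0 * (p * q) = A 0 1,
      disc A = (A 1 0 * (p + q)) ^+ 2 & p + q != 0].
Proof.
move=> hp hq; rewrite det2 => hd /(lft_fixed (Im_neq0 hp)) P.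
have q0 : - q != 0 by rewrite oppr_eq0 Im_neq0.
move=> /(lft_fixed q0) Q.
have pq : p + q != 0.
  by apply: Im_neq0; rewrite /upper_half_plane ImD addr_gt0.
have E1 : A 1 0 * (p - q) = A 0 0 - A 1 1.
  apply: (mulIf pq); apply/eqP; rewrite -subr_eq0; apply/eqP.
  by rewrite -[RHS]subr0 -{2}Q -P; ring.
have E2 : A 1 0 * (p * q) = A 0 1.
  have := P; have -> : A 1 1 - A 0 0 = - (A 1 0 * (p - q)) by rewrite E1; ring.
  by move=> /eqP; rewrite subr_eq0 => /eqP <-; ring.
split => //; rewrite /disc trace2.
have -> : (A 0 0 + A 1 1) ^+ 2 - 4 =
  (A 0 0 - A 1 1) ^+ 2 + 4 * (A 0 0 * A 1 1 - A 0 1 * A 1 0) + 4 * A 0 1 * A 1 0 - 4 by ring.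
rewrite hd -E1 -E2; ring.
Qed.

Lemma disc0_scalar A p q : upper_half_plane p -> upper_half_plane q ->
  \det A = 1 -> p = lft A p -> - q = lft A (- q) -> disc A = 0 ->
  [/\ A 1 0 = 0, A 0 1 = 0 & A 0 0 = A 1 1].
Proof.
move=> hp hq hd P Q D0; have [E1 E2 E3 pq] := two_fixed_points hp hq hd P Q.
have c0 : A 1 0 = 0.
  move: D0; rewrite E3 => /eqP; rewrite sqrf_eq0 mulf_eq0 (negbTE pq) orbF.
  by move/eqP.
split => //; first by rewrite -E2 c0 mul0r.
by apply/eqP; rewrite -subr_eq0 -E1 c0 mul0r.
Qed.

End FixedPoints.

(** * Zeros of the discriminant *)

Section Discriminant.
Variable R : realType.
Implicit Types (T : R[i] -> 'M[R[i]]_2) (z w : R[i]).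

(** Translating by ['i] turns the upper half-plane into a neighbourhood of the real
    line, where [identity_theorem] applies. *)
Lemma identity_upper (f : R[i] -> R[i]) : (forall z, exists l, cderiv f z l) ->
  (forall z, upper_half_plane z -> f z = 0) -> forall z, f z = 0.
Proof.
move=> fd f0 z; rewrite -[z](subrK 'i%C).
apply: (@identity_theorem R (fun w => f (w + 'i%C)) 0).
  by move=> w; have [l H] := fd (w + 'i%C); exists l; exact: cderiv_shift.
move=> d d0; exists (d / 2); split; first by rewrite gt_eqF // divr_gt0.
  by rewrite subr0 gtr0_norm ?divr_gt0 //; lra.
by apply: f0; rewrite /upper_half_plane ImD /= add0r.
Qed.

Lemma entire_disc T : entire_SL T -> forall z, exists l, cderiv (fun w => disc (T w)) z l.
Proof.
move=> [hT _ _] z.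
have [l0 h0] := holomorphic_cderiv (hT z 0 0).
have [l1 h1] := holomorphic_cderiv (hT z 1 1).
have hs := cderivD h0 h1.
have := cderivD (cderivM hs hs) (cderiv_cst (-4) z).
move=> H; eexists; apply: (@eq_cderiv _ _ _ _ _ 1 _ _ H) => // w _.
by rewrite /disc trace2 expr2.
Qed.

Lemma entire_entry T i j : entire_SL T -> forall z, exists l, cderiv (fun w => T w i j) z l.
Proof. by move=> [hT _ _] z; exact: holomorphic_cderiv. Qed.

(** If the zeros clustered, the discriminant would vanish identically. Then [T]
    would be scalar on the upper half-plane, since distinct fixed points exclude a
    double root of a genuine quadratic equation, and scalar everywhere by the
    identity theorem. The diagonal entry squares to 1, so one of the two signs
    occurs on a set of real points clustering at the origin, and [T] would be that
    constant. *)
Lemma disc_isolated (mp mm : R[i] -> R[i]) T :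
  herglotz mp -> herglotz mm -> entire_SL T ->
  ~ (forall z, T z = 1) -> ~ (forall z, T z = -1) ->
  (forall z, upper_half_plane z -> mp z = lft (T z) (mp z)) ->
  (forall z, upper_half_plane z -> - mm z = lft (T z) (- mm z)) ->
  forall x0 : R, exists2 d : R, 0 < d &
    forall x, x != x0 -> `|x - x0| < d -> disc (T x%:C) != 0.
Proof.
move=> hmp hmm hT hT1 hTN1 hp hm x0; apply: contrapT => N.
have [hol det1 _] := hT.
have D0 z : disc (T z) = 0.
  apply: (@identity_theorem _ _ x0 (entire_disc hT)) => d d0; apply: contrapT => N'.
  apply: N; exists d => // x xx0 xd; apply/eqP => Dx.
  by apply: N'; exists x; split.
have sc z : upper_half_plane z ->
    [/\ T z 1 0 = 0, T z 0 1 = 0 & T z 0 0 = T z 1 1].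
  move=> hz; apply: (disc0_scalar (proj2 (hmp z hz)) (proj2 (hmm z hz))) => //.
  - exact: hp.
  - exact: hm.
have c0 := identity_upper (entire_entry 1 0 hT) (fun z hz => let: And3 h _ _ := sc z hz in h).
have b0 := identity_upper (entire_entry 0 1 hT) (fun z hz => let: And3 _ h _ := sc z hz in h).
have addC : forall z, exists l, cderiv (fun w => T w 0 0 - T w 1 1) z l.
  move=> z; have [l0 h0] := entire_entry 0 0 hT z; have [l1 h1] := entire_entry 1 1 hT z.
  by exists (l0 - l1); exact: cderivD h0 (cderivN h1).
have ad : forall z, T z 0 0 = T z 1 1.
  move=> z; apply/eqP; rewrite -subr_eq0; apply/eqP.
  apply: (identity_upper addC) => w hw; have [_ _ ->] := sc w hw; exact: subrr.
have a2 z : (T z 0 0 - 1) * (T z 0 0 + 1) = 0.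
  have := det1 z; rewrite det2 c0 b0 -ad mulr0 subr0 => a1.
  have -> : (T z 0 0 - 1) * (T z 0 0 + 1) = T z 0 0 * T z 0 0 - 1 by ring.
  by rewrite a1 subrr.
have aD (k : R[i]) : forall z, exists l, cderiv (fun w => T w 0 0 + k) z l.
  move=> z; have [l0 h0] := entire_entry 0 0 hT z.
  by exists (l0 + 0); exact: cderivD h0 (cderiv_cst k z).
have [acc|] := pselect (forall d : R, 0 < d ->
    exists x, [/\ x != 0, `|x - 0| < d & T x%:C 0 0 - 1 = 0]).
  apply: hT1 => z; have := identity_theorem (aD (-1)) acc z.
  by move/eqP; rewrite subr_eq0 => /eqP a1; apply: mx2P; rewrite ?c0 ?b0 -?ad ?a1 !mxE.
move=> /existsNP[d /not_implyP[d0 /forallNP Nd]].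
apply: hTN1 => z.
have : T z 0 0 + 1 = 0.
  apply: (@identity_theorem _ _ 0 (aD 1)) => e e0.
  pose x := Num.min d e / 2.
  have m0 : 0 < Num.min d e by rewrite lt_min d0.
  have x0' : 0 < x by rewrite divr_gt0.
  have [xd xe] : x < d /\ x < e.
    have : Num.min d e <= d by rewrite ge_min lexx.
    have : Num.min d e <= e by rewrite ge_min lexx orbT.
    by rewrite /x; split; lra.
  exists x; split; [by rewrite gt_eqF|by rewrite subr0 gtr0_norm|].
  have /eqP := a2 x%:C; rewrite mulf_eq0 => /orP[/eqP ax|/eqP //].
  by exfalso; apply: (Nd x); split; [by rewrite gt_eqF|by rewrite subr0 gtr0_norm|].
move/eqP; rewrite addr_eq0 => /eqP a1.
by apply: mx2P; rewrite ?c0 ?b0 -?ad ?a1 !mxE /= ?oppr0.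
Qed.

Lemma real_entries T (x : R) : entire_SL T ->
  exists S : 'M[R]_2, forall i j, T x%:C i j = (S i j)%:C.
Proof.
by move=> [_ _ hr]; have [S ->] := hr x; exists S => i j; rewrite mxE.
Qed.

End Discriminant.

(** * Boundary values on the real line *)

Section BoundaryValues.
Variable R : realType.
Implicit Types (f g m : R[i] -> R[i]) (z w s : R[i]) (x e k r : R).

Lemma ccontV f z : ccont f z -> f z != 0 -> ccont (fun w => (f w)^-1) z.
Proof.
move=> fc f0 e e0; have m0 : 0 < modc (f z) by rewrite modc_gt0.
have m2 : 0 < modc (f z) / 2 by rewrite divr_gt0.
have em : 0 < e * (modc (f z) ^+ 2 / 2) by rewrite mulr_gt0 // divr_gt0 // exprn_gt0.
have [d1 d10 H1] := fc _ m2; have [d2 d20 H2] := fc _ em.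
exists (Num.min d1 d2); first by rewrite lt_min d10.
move=> w; rewrite lt_min => /andP[/H1 h1 /H2 h2].
have hw : modc (f z) / 2 < modc (f w).
  have := modc_sum_lb (f z) (f w - f z).
  by have -> : f z + (f w - f z) = f w by [ring]; lra.
have w0 : 0 < modc (f w) by apply: lt_trans hw.
have fw0 : f w != 0 by rewrite -modc_gt0.
have -> : (f w)^-1 - (f z)^-1 = (f z - f w) / (f w * f z) by field; rewrite f0 fw0.
rewrite modcM modcV modcM modcC ltr_pdivrMr ?mulr_gt0 //.
apply: (lt_le_trans h2); rewrite ler_pM2l // expr2.
have := ltW hw; rewrite -(ler_pM2r m0); lra.
Qed.

Lemma ccont_neq0 f z : ccont f z -> f z != 0 ->
  exists2 d : R, 0 < d & forall w, modc (w - z) < d -> f w != 0.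
Proof.
move=> fc f0; have m0 : 0 < modc (f z) by rewrite modc_gt0.
have [d d0 dP] := fc _ m0; exists d => // w /dP.
by apply: contraTneq => ->; rewrite sub0r modcN ltxx.
Qed.

Lemma boundary_valueP m x w :
  (forall e, 0 < e -> exists2 d : R, 0 < d &
    forall y, 0 < y -> y < d -> modc (m (x +i* y) - w) < e) ->
  boundary_value m x w.
Proof.
move=> H; apply/(@cvgrPdist_lt _ (R[i]^o)) => e /ltc_real[r r0 ->].
have [d d0 dP] := H r r0.
rewrite /at_right /within /=; apply/nbhs_ballP; exists d => // y.
rewrite /ball /= sub0r normrN => yd y0; rewrite modc_ltE modcC; apply: dP => //.
by rewrite gtr0_norm in yd.
Qed.

(** [s] is close to one of the two square roots of [- k ^ 2], and the sign of its
    imaginary part selects which one. *)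
Lemma near_sqrt_neg s k e : 0 < k -> 0 <= complex.Im s ->
  modc (s * s + (k ^+ 2)%:C) <= e * k -> modc (s - 'i%C * k%:C) <= e.
Proof.
move=> k0 s0.
have -> : s * s + (k ^+ 2)%:C = (s - 'i%C * k%:C) * (s + 'i%C * k%:C).
  have ii : 'i%C * 'i%C = -1 :> R[i] by rewrite -expr2 sqr_i.
  have -> : (s - 'i%C * k%:C) * (s + 'i%C * k%:C) = s * s - ('i%C * 'i%C) * (k%:C * k%:C) by ring.
  by rewrite ii mulN1r opprK expr2 rmorphM.
rewrite modcM => H.
have kle : k <= modc (s + 'i%C * k%:C).
  apply: le_trans (ler_Im_modc _); apply: le_trans (ler_norm _).
  by rewrite !ReImE /= mul0r add0r mul1r lerDr.
have m0 := modc_ge0 (s - 'i%C * k%:C).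
rewrite -(ler_pM2r k0); apply: le_trans H; exact: ler_wpM2l.
Qed.

(** A square root of a number close to the nonnegative reals is almost real:
    twice the squared imaginary part is [modc (s ^ 2) - Re (s ^ 2)]. *)
Lemma near_sqrt_pos s r e : 0 <= r -> 0 <= e ->
  modc (s * s - r%:C) <= e ^+ 2 -> `|complex.Im s| <= e.
Proof.
move=> r0 e0 H.
have h1 := le_trans (ler_Re_modc _) H.
have h2 := modcD (s * s - r%:C) r%:C.
rewrite subrK modc_real ger0_norm // modcM -expr2 modc_sqr in h2.
move: h1; rewrite !ReImE /= ler_norml => /andP[h1 _].
rewrite -(@ler_pXn2r _ 2%N) ?nnegrE // real_normK ?num_real //; nra.
Qed.

Variables (mp mm : R[i] -> R[i]) (T : R[i] -> 'M[R[i]]_2).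
Hypotheses (hmp : herglotz mp) (hmm : herglotz mm) (hT : entire_SL T).
Hypothesis hp : forall z, upper_half_plane z -> mp z = lft (T z) (mp z).
Hypothesis hm : forall z, upper_half_plane z -> - mm z = lft (T z) (- mm z).

Let key z : upper_half_plane z -> [/\ T z 1 0 * (mp z - mm z) = T z 0 0 - T z 1 1,
  T z 1 0 * (mp z * mm z) = T z 0 1,
  disc (T z) = (T z 1 0 * (mp z + mm z)) ^+ 2 & mp z + mm z != 0].
Proof.
move=> hz; have [_ hd _] := hT.
by apply: two_fixed_points; [exact: (hmp hz).2|exact: (hmm hz).2|exact: hd|exact: hp|exact: hm].
Qed.

Let cT i j z : ccont (fun w => T w i j) z.
Proof. by have [l H] := entire_entry i j hT z; exact: cderiv_ccont H. Qed.

Let cD z : ccont (fun w => disc (T w)) z.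
Proof. by have [l H] := entire_disc hT z; exact: cderiv_ccont H. Qed.

(** For [D < 0] the fixed points of the real matrix [T x] are two conjugate
    non-real numbers. The sum and difference of [mp] and [mm] are a square root of
    [disc (T z) / c ^ 2] and the number [(a - d) / c], where [a, b, c, d] are the
    entries of [T z]; both extend continuously to [x]. *)
Lemma reflectionless_at x (D : R) : disc (T x%:C) = D%:C -> D < 0 ->
  exists wp wm : R[i],
      [/\ boundary_value mp x wp, boundary_value mm x wm & wp = - wm^*].
Proof.
move=> DE D0; have [S SE] := real_entries x hT.
have hd : S 0 0 * S 1 1 - S 0 1 * S 1 0 = 1.
  have [_ hd _] := hT; have := hd x%:C; rewrite det2 !SE -!rmorphM -rmorphB /=.
  by move=> /(congr1 (@complex.Re R)).
have DS : D = (S 0 0 - S 1 1) ^+ 2 + 4 * (S 0 1 * S 1 0).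
  have : D = (S 0 0 + S 1 1) ^+ 2 - 4.
    by apply: complexI; rewrite -DE /disc trace2 !SE rmorphB rmorphXn rmorphD /= rmorph_nat.
  move=> ->; have -> : (S 0 0 + S 1 1) ^+ 2 - 4 = (S 0 0 - S 1 1) ^+ 2 +
    4 * (S 0 1 * S 1 0) + 4 * (S 0 0 * S 1 1 - S 0 1 * S 1 0) - 4 by ring.
  by rewrite hd; ring.
set c := S 1 0 in DS.
have c0 : c != 0.
  apply: contraTneq D0 => c0; rewrite DS c0 !mulr0 addr0 -leNgt; exact: sqr_ge0.
pose al := (S 0 0 - S 1 1) / c.
pose k := Num.sqrt (- D) / `|c|.
have k0 : 0 < k by rewrite divr_gt0 ?normr_gt0 // sqrtr_gt0 oppr_gt0.
have kE : k ^+ 2 = - D / c ^+ 2.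
  by rewrite /k expr_div_n sqr_sqrtr ?oppr_ge0 ?ltW // real_normK ?num_real.
have cx : T x%:C 1 0 != 0 by rewrite SE; apply: contra c0 => /eqP H; apply/eqP; exact: complexI H.
have [d1 d10 cne] := ccont_neq0 (cT 1 0 x%:C) cx.
have cG1 : ccont (fun z => disc (T z) * ((T z 1 0)^-1 * (T z 1 0)^-1)) x%:C.
  by apply: ccontM => //; apply: ccontM; exact: ccontV.
have cG2 : ccont (fun z => (T z 0 0 + -1 * T z 1 1) * (T z 1 0)^-1) x%:C.
  apply: ccontM; last exact: ccontV.
  have [l0 h0] := entire_entry 0 0 hT x%:C; have [l1 h1] := entire_entry 1 1 hT x%:C.
  exact: cderiv_ccont (cderivD h0 (cderivM (cderiv_cst (-1) _) h1)).
have G1x : disc (T x%:C) * ((T x%:C 1 0)^-1 * (T x%:C 1 0)^-1) = - (k ^+ 2)%:C.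
  by rewrite kE DE SE mulNr rmorphN opprK rmorphM fmorphV expr2 rmorphM invfM.
have G2x : (T x%:C 0 0 + -1 * T x%:C 1 1) * (T x%:C 1 0)^-1 = al%:C.
  by rewrite !SE mulN1r /al rmorphM fmorphV rmorphB.
(* The fixed points of [T x] are [wp] and [- wm]. *)
pose wp : R[i] := (al / 2) +i* (k / 2); pose wm : R[i] := (- al / 2) +i* (k / 2).
have two_wp : 2 * wp = al%:C + 'i%C * k%:C.
  by apply/eqP; rewrite eq_complex !ReImE /=; apply/andP; split; apply/eqP; field.
have two_wm : 2 * wm = 'i%C * k%:C - al%:C.
  by apply/eqP; rewrite eq_complex !ReImE /=; apply/andP; split; apply/eqP; field.
have modc2 : modc (2 : R[i]) = 2.
  by have := modc_real (2 : R); rewrite rmorph_nat ger0_norm.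
have near e : 0 < e -> exists2 d : R, 0 < d & forall y, 0 < y -> y < d ->
    modc (mp (x +i* y) - wp) < e /\ modc (mm (x +i* y) - wm) < e.
  move=> e0; have ek : 0 < e / 2 * k by rewrite mulr_gt0 // divr_gt0.
  have [d2 d20 H1] := cG1 _ ek; have [d3 d30 H2] := cG2 _ e0.
  exists (Num.min d1 (Num.min d2 d3)); first by rewrite !lt_min d10 d20.
  move=> y y0; rewrite !lt_min => /and3P[yd1 yd2 yd3].
  have zx : modc (x +i* y - x%:C) = y.
    have -> : x +i* y - x%:C = 'i%C * y%:C by rewrite (complex_split x y); ring.
    by rewrite modcM modc_i mul1r modc_real gtr0_norm.
  have hz : upper_half_plane (x +i* y)%C by [].
  have := H1 (x +i* y)%C; have := H2 (x +i* y)%C; have := cne (x +i* y)%C.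
  rewrite zx => /(_ yd1) cz /(_ yd3) + /(_ yd2).
  have [] := key hz; have := (hmp hz).2; have := (hmm hz).2.
  rewrite /upper_half_plane G1x G2x.
  set p := mp _; set q := mm _; set z := (x +i* y)%C => hq hp' E1 _ E3 pq0.
  have -> : (T z 0 0 + -1 * T z 1 1) * (T z 1 0)^-1 = p - q.
    by rewrite mulN1r -E1 mulrC mulKf.
  have -> : disc (T z) * ((T z 1 0)^-1 * (T z 1 0)^-1) = (p + q) * (p + q).
    by rewrite E3; field.
  rewrite opprK => B2 /ltW B1'.
  have B1 : modc (p + q - 'i%C * k%:C) <= e / 2.
    by apply: near_sqrt_neg => //; rewrite ImD addr_ge0 // ltW.
  have -> : modc (p - wp) < e = (2 * modc (p - wp) < 2 * e) by rewrite ltr_pM2l.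
  have -> : modc (q - wm) < e = (2 * modc (q - wm) < 2 * e) by rewrite ltr_pM2l.
  rewrite -{1 3}modc2 -!modcM !mulrBr two_wp two_wm.
  have -> : 2 * p - (al%:C + 'i%C * k%:C) = (p + q - 'i%C * k%:C) + (p - q - al%:C) by ring.
  have -> : 2 * q - ('i%C * k%:C - al%:C) = (p + q - 'i%C * k%:C) - (p - q - al%:C) by ring.
  have := modcD (p + q - 'i%C * k%:C) (p - q - al%:C).
  have := modcB (p + q - 'i%C * k%:C) (p - q - al%:C).
  by split; lra.
exists wp, wm; split.
- apply: boundary_valueP => e /near[d d0 dP]; exists d => // y y0 yd.
  by have [] := dP y y0 yd.
- apply: boundary_valueP => e /near[d d0 dP]; exists d => // y y0 yd.
  by have [] := dP y y0 yd.
- by rewrite /wp /wm /=; apply/eqP; rewrite eq_complex /= mulNr !opprK !eqxx.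
Qed.

Lemma Im_sqrt_vanish (N G : R[i] -> R[i]) x r (d : R) : 0 < d -> 0 <= r ->
  (forall z, upper_half_plane z -> modc (z - x%:C) < d -> N z * N z = G z) ->
  ccont G x%:C -> G x%:C = r%:C ->
  forall e, 0 < e -> exists2 d' : R, 0 < d' &
    forall z, upper_half_plane z -> modc (z - x%:C) < d' -> `|complex.Im (N z)| <= e.
Proof.
move=> d0 r0 NG Gc Gx e e0.
have e2 : 0 < e ^+ 2 by rewrite exprn_gt0.
have [d1 d10 H] := Gc _ e2.
exists (Num.min d d1); first by rewrite lt_min d0.
move=> z hz; rewrite lt_min => /andP[zd /H zd1].
by apply: (near_sqrt_pos r0 (ltW e0)); rewrite NG // -Gx ltW.
Qed.

(** The squares of the diagonal entries of [M] are [c ^ 2 / disc] and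
    [b ^ 2 / disc], where [b] and [c] are the off-diagonal entries of [T]. Where
    the discriminant is positive both extend continuously to nonnegative
    numbers on the real line, so the entries themselves become real. *)
Lemma ImM_vanish x (D : R) i : disc (T x%:C) = D%:C -> 0 < D ->
  forall e, 0 < e -> exists2 d : R, 0 < d &
    forall z, upper_half_plane z -> modc (z - x%:C) < d ->
      `|complex.Im (M_matrix (mp, mm) z i i)| <= e.
Proof.
move=> DE D0; have [S SE] := real_entries x hT.
have Dx : disc (T x%:C) != 0.
  by rewrite DE; apply: contraTneq D0 => /complexI ->; rewrite ltxx.
have [d d0 Dne] := ccont_neq0 (cD x%:C) Dx.
have gen (j l : 'I_2) : ccont (fun z => T z j l * T z j l * (disc (T z))^-1) x%:C.
  by apply: ccontM; [exact: ccontM|exact: ccontV].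
have genx (j l : 'I_2) : T x%:C j l * T x%:C j l * (disc (T x%:C))^-1 = (S j l ^+ 2 / D)%:C.
  by rewrite DE !SE rmorphM fmorphV expr2 rmorphM.
have ge (j l : 'I_2) : 0 <= S j l ^+ 2 / D by rewrite divr_ge0 ?sqr_ge0 ?ltW.
have cne z : upper_half_plane z -> modc (z - x%:C) < d -> T z 1 0 != 0.
  move=> hz /Dne; have [_ _ -> _] := key hz; apply: contraNneq => ->.
  by rewrite mul0r expr0n.
have [i0|i1] : i = 0 \/ i = 1.
  by case: i => -[|[|//]] H; [left|right]; apply: val_inj.
- apply: (Im_sqrt_vanish d0 (ge 1 0) _ (gen 1 0) (genx 1 0)) => z hz zd.
  have [_ _ E3 pq] := key hz; have c0 := cne z hz zd.
  by rewrite /M_matrix mxE /= i0 !eqxx /= E3; field; rewrite pq c0.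
- apply: (Im_sqrt_vanish d0 (ge 0 1) _ (gen 0 1) (genx 0 1)) => z hz zd.
  have [_ E2 E3 pq] := key hz; have c0 := cne z hz zd.
  by rewrite /M_matrix mxE /= i1 eqxx /= E3 -E2; field; rewrite pq c0.
Qed.

End BoundaryValues.

(** * Poisson integrals and mass of intervals *)

Section Stieltjes.
Variable R : realType.
Notation measR := {measure set (measurableTypeR R) -> \bar R}.
Implicit Types (x y t : R) (m : measR) (rho : matrix_measure R).

Definition poisson x y : R -> R := fun t => y / ((t - x) ^+ 2 + y ^+ 2).

Lemma poisson_den x y t : 0 < y -> 0 < (t - x) ^+ 2 + y ^+ 2.
Proof. by move=> y0; rewrite ltr_wpDl ?sqr_ge0 ?exprn_gt0. Qed.

Lemma Im_herglotz_kernel x y t : 0 < y ->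
  complex.Im (herglotz_kernel (x +i* y) t) = poisson x y t.
Proof.
move=> y0; rewrite /herglotz_kernel /poisson !ReImE /= oppr0 addr0.
by rewrite sub0r sqrrN mulNr opprK.
Qed.

Lemma continuous_poisson x y : 0 < y -> continuous (poisson x y).
Proof.
move=> y0 t; apply: cvgM; first exact: cvg_cst.
apply: cvgV; first by rewrite gt_eqF // poisson_den.
apply: cvgD; last exact: cvg_cst.
rewrite /GRing.exp /=; apply: cvgM; apply: cvgB; [exact: cvg_id|exact: cvg_cst|exact: cvg_id|exact: cvg_cst].
Qed.

Lemma poisson_le x y t : 0 < y ->
  poisson x y t <= y * (2 + (1 + 2 * x ^+ 2) / y ^+ 2) * (1 + t ^+ 2)^-1.
Proof.
move=> y0; have y2 : 0 < y ^+ 2 by rewrite exprn_gt0.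
have t1 : 0 < 1 + t ^+ 2 by rewrite ltr_pwDl ?sqr_ge0.
rewrite /poisson -mulrA ler_pM2l // ler_pdivlMr // mulrC ler_pdivrMr ?poisson_den //.
set C := _ / y ^+ 2; have CE : C * y ^+ 2 = 1 + 2 * x ^+ 2 by rewrite /C divfK // gt_eqF.
have C0 : 0 <= C by rewrite /C divr_ge0 ?ltW //; have := sqr_ge0 x; lra.
have : 0 <= C * (t - x) ^+ 2 by rewrite mulr_ge0 ?sqr_ge0.
have := sqr_ge0 (t - 2 * x).
have -> : (2 + C) * ((t - x) ^+ 2 + y ^+ 2) =
  2 * (t - x) ^+ 2 + 2 * y ^+ 2 + C * (t - x) ^+ 2 + C * y ^+ 2 by ring.
rewrite CE; have := sqr_ge0 y; nra.
Qed.

Lemma integrable_poisson m x y : 0 < y ->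
  m.-integrable setT (fun t : R => ((1 + t ^+ 2)^-1)%:E) ->
  m.-integrable setT (fun t : R => (poisson x y t)%:E).
Proof.
move=> y0 /(integrableZl measurableT (y * (2 + (1 + 2 * x ^+ 2) / y ^+ 2))).
apply: le_integrable => //.
  apply/measurable_EFinP; apply: continuous_measurable_fun; exact: continuous_poisson.
move=> t _ /=; rewrite lee_fin.
have p0 : 0 <= poisson x y t by rewrite divr_ge0 ?ltW ?poisson_den.
rewrite ger0_norm //; apply: (le_trans (poisson_le x t y0)); exact: ler_norm.
Qed.

(** The Poisson kernel is at least [1 / (2 y)] on [I] and nonnegative elsewhere. The
    positive measure [m2 - m1] may fail to make sense on unbounded sets, hence the
    comparison of two integrals. *)
Lemma poisson_mass (m1 m2 : measR) x y (I : set (measurableTypeR R)) : 0 < y ->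
  (forall A, measurable A -> (m1 A <= m2 A)%E) -> measurable I ->
  (forall t : R, I t -> `|t - x| <= y) ->
  m1.-integrable setT (fun t : R => ((1 + t ^+ 2)^-1)%:E) ->
  m2.-integrable setT (fun t : R => ((1 + t ^+ 2)^-1)%:E) ->
  fine (m2 I) - fine (m1 I) <=
    2 * y * (Rintegral m2 setT (poisson x y) - Rintegral m1 setT (poisson x y)).
Proof.
move=> y0 m12 mI Ixy i1 i2.
have P1 := integrable_poisson x y0 i1; have P2 := integrable_poisson x y0 i2.
have p0 t : 0 <= poisson x y t by rewrite divr_ge0 ?ltW ?poisson_den.
pose oneI : measurableTypeR R -> R := fun t => \1_I t.
have low t : (2 * y)^-1 * oneI t <= poisson x y t.
  rewrite /oneI indicE; case: (boolP (t \in I)) => tI; last by rewrite mulr0.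
  have /Ixy tx : I t by move: tI; rewrite inE.
  rewrite mulr1 /poisson ler_pdivlMr ?poisson_den // mulrC ler_pdivrMr ?mulr_gt0 //.
  have : (t - x) ^+ 2 <= y ^+ 2.
    by rewrite -[(t - x) ^+ 2]real_normK ?num_real // ler_pXn2r ?nnegrE ?(ltW y0).
  nra.
have mind : measurable_fun setT (fun t => (2 * y)^-1 * oneI t).
  apply: measurable_funM; [exact: measurable_cst|exact: measurable_indic].
have ind (m : measR) : m.-integrable setT (EFin \o poisson x y) ->
    m.-integrable setT (EFin \o (fun t => (2 * y)^-1 * oneI t)).
  apply: le_integrable => //; first by apply/measurable_EFinP.
  move=> t _ /=; rewrite lee_fin [leRHS]ger0_norm // ger0_norm ?low //.
  by rewrite mulr_ge0 ?invr_ge0 ?mulr_ge0 ?(ltW y0) // /oneI indicE; case: (_ \in _).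
have I1 := ind _ P1; have I2 := ind _ P2.
have ind1 (m : measR) : m.-integrable setT (EFin \o poisson x y) ->
    m.-integrable setT (EFin \o oneI).
  move=> /ind/(integrableZl measurableT (2 * y)); apply: le_integrable => //.
    by apply/measurable_realfun.measurable_EFinP; exact: measurable_indic.
  by move=> t _ /=; rewrite mulrA divff ?mul1r // gt_eqF // mulr_gt0.
have mass (m : measR) : m.-integrable setT (EFin \o poisson x y) ->
    Rintegral m setT (fun t => poisson x y t - (2 * y)^-1 * oneI t) =
    Rintegral m setT (poisson x y) - (2 * y)^-1 * fine (m I).
  move=> Pm; rewrite RintegralB //; last exact: ind.
  rewrite [X in _ - X]RintegralZl //; last exact: (ind1 m Pm).
  by congr (_ - _ * _); rewrite /Rintegral /oneI integral_indic // setIT.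
have fin (m : measR) : m.-integrable setT (EFin \o poisson x y) ->
    (\int[m]_t (poisson x y t - (2 * y)^-1 * oneI t)%:E)%E \is a fin_num.
  move=> Pm; apply: integrable_fin_num => //.
  have := integrableB measurableT Pm (ind _ Pm).
  by apply: eq_integrable.
have : Rintegral m1 setT (fun t => poisson x y t - (2 * y)^-1 * oneI t) <=
       Rintegral m2 setT (fun t => poisson x y t - (2 * y)^-1 * oneI t).
  rewrite /Rintegral; apply: fine_le; [exact: fin|exact: fin|].
  apply: ge0_le_measure_integral => //.
    by move=> t; rewrite lee_fin subr_ge0.
  apply/measurable_EFinP; apply: measurable_funB => //.
  by apply: continuous_measurable_fun; exact: continuous_poisson.
rewrite mass // mass // => H.
rewrite -(ler_pM2l (x := (2 * y)^-1)) ?invr_gt0 ?mulr_gt0 // mulrA mulVf ?mul1r; first by lra.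
by rewrite gt_eqF // mulr_gt0.
Qed.

End Stieltjes.

(** * Support of the matrix measure *)

Section Support.
Variable R : realType.
Implicit Types (x y t a b : R) (i j : 'I_2) (A B : set (measurableTypeR R)).

Lemma bounded_setP (A : set R) (r : R) : (forall t, A t -> `|t| <= r) -> bounded_set A.
Proof.
move=> H; exists r; split; first exact: num_real.
by move=> M rM t /= /H /le_trans; apply; exact: ltW.
Qed.

Lemma psd_diag (K : realType) (S : 'M[K]_2) i : symmetric_psd S -> 0 <= S i i.
Proof.
move=> [_ /(_ (delta_mx 0 i))].
by rewrite -rowE trmx_delta -colE !mxE.
Qed.

(** Testing the form on the vectors [(1, s)] gives [0 <= s * S 0 1] for both signs
    of [s]. *)
Lemma psd_diag0 (K : realType) (S : 'M[K]_2) : symmetric_psd S -> S 0 0 = 0 -> S 1 1 = 0 -> S = 0.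
Proof.
move=> [sym pos] S0 S1.
have S10 : S 1 0 = S 0 1 by rewrite -[in LHS]sym mxE.
have form (s : K) : 0 <= s * S 0 1.
  have := pos (\row_j (if j == 0 then 1 else s)).
  rewrite mxE !big_ord_recl big_ord0 !mxE !big_ord_recl !big_ord0 !mxE /=.
  have -> : lift 0 0 = 1 :> 'I_2 by apply: val_inj.
  by rewrite S0 S1 S10 /= !(mul1r, mulr1, mulr0, addr0, add0r); lra.
have S01 : S 0 1 = 0.
  by apply/le_anti; have := form 1; have := form (-1); rewrite mulN1r mul1r oppr_ge0 => -> ->.
by apply: mx2P; rewrite ?S10 ?S01 ?S0 ?S1 !mxE.
Qed.

Variables (rho : matrix_measure R) (M : R[i] -> 'M[R[i]]_2).
Hypothesis hrho : herglotz_measure M rho.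

Lemma mm_diag_ge0 A i : measurable A -> bounded_set (A : set R) -> 0 <= mm_val rho A i i.
Proof. by move=> mA bA; apply: psd_diag; exact: mm_psd. Qed.

Lemma mm_neg_fin A i : measurable A -> bounded_set (A : set R) -> mm_neg rho i i A \is a fin_num.
Proof.
by move=> mA bA; have [_ H] := mm_finite rho i i mA bA; rewrite ge0_fin_numE.
Qed.

Lemma mm_pos_fin A i : measurable A -> bounded_set (A : set R) -> mm_pos rho i i A \is a fin_num.
Proof.
by move=> mA bA; have [H _] := mm_finite rho i i mA bA; rewrite ge0_fin_numE.
Qed.

Lemma mm_neg_le_pos_bounded A i : measurable A -> bounded_set (A : set R) ->
  (mm_neg rho i i A <= mm_pos rho i i A)%E.
Proof.
move=> mA bA; have := mm_diag_ge0 i mA bA; rewrite /mm_val mxE subr_ge0 => H.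
by rewrite -(fineK (mm_neg_fin i mA bA)) -(fineK (mm_pos_fin i mA bA)) lee_fin.
Qed.

(** The diagonal entries of a positive semidefinite matrix measure are positive
    measures; this extends from bounded sets by continuity from below. *)
Lemma mm_neg_le_pos A i : measurable A -> (mm_neg rho i i A <= mm_pos rho i i A)%E.
Proof.
move=> mA; pose F n : set (measurableTypeR R) := A `&` `[- n%:R, n%:R]%classic.
have mF n : measurable (F n) by apply: measurableI => //; exact: measurable_itv.
have FA : \bigcup_n F n = A.
  apply/seteqP; split=> [t [n _ []//]|t At].
  exists (Num.bound `|t|) => //; split => //=.
  by rewrite in_itv /= -ler_norml ltW // archi_boundP.
have ndF : nondecreasing_seq F.
  move=> n k nk; apply/subsetPset => t [At]; rewrite /= !in_itv /= -!ler_norml => tn.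
  by split => //=; rewrite in_itv /= -ler_norml (le_trans tn) // ler_nat.
have mU : measurable (\bigcup_n F n) by rewrite FA.
have c1 := nondecreasing_cvg_mu (mu := mm_neg rho i i) mF mU ndF.
have c2 := nondecreasing_cvg_mu (mu := mm_pos rho i i) mF mU ndF.
rewrite FA in c1 c2; apply: (lee_cvg_to c1 c2); apply: nearW => n /=.
apply: mm_neg_le_pos_bounded => //; apply: (@bounded_setP _ n%:R) => t [_].
by rewrite /= in_itv /= -ler_norml.
Qed.

Lemma mm_diagU A B i : measurable A -> measurable B -> bounded_set (A : set R) ->
  bounded_set (B : set R) -> A `&` B = set0 ->
  mm_val rho (A `|` B) i i = mm_val rho A i i + mm_val rho B i i.
Proof.
move=> mA mB bA bB AB; rewrite /mm_val !mxE !measureU // !fineD ?mm_pos_fin ?mm_neg_fin //.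
ring.
Qed.

(** Easy half of Stieltjes inversion: [Im (M i i)] is the Poisson integral of the
    [i]-th diagonal measure plus a nonnegative linear term. *)
Lemma mm_mass_le (I : set (measurableTypeR R)) x y i : 0 < y -> measurable I ->
  (forall t : R, I t -> `|t - x| <= y) ->
  mm_val rho I i i <= 2 * y * complex.Im (M (x +i* y) i i).
Proof.
move=> y0 mI Ixy; have [hint [A0 [B [_ hB hM]]]] := hrho.
have hz : upper_half_plane (x +i* y)%C by [].
rewrite hM // !ReImE /= !mul0r !addr0 add0r.
have E (m : {measure set (measurableTypeR R) -> \bar R}) :
    Rintegral m setT (fun t => complex.Im (herglotz_kernel (x +i* y) t)) =
    Rintegral m setT (poisson x y).
  by apply: eq_Rintegral => t _; exact: Im_herglotz_kernel.
rewrite !E.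
have By : 0 <= B i i * y by rewrite mulr_ge0 ?(ltW y0) // psd_diag.
have [ip im] := hint i i.
have H := poisson_mass y0 (fun A mA => mm_neg_le_pos i mA) mI Ixy im ip.
rewrite /mm_val mxE; apply: (le_trans H).
by rewrite ler_pM2l ?mulr_gt0 // lerDr.
Qed.

Definition Im_vanishes_at X i := forall e, 0 < e -> exists2 d : R, 0 < d &
  forall z, upper_half_plane z -> modc (z - X%:C) < d -> `|complex.Im (M z i i)| <= e.

Let itvco a b : set (measurableTypeR R) := `[a, b[%classic.

Lemma itvco_bounded a b : bounded_set (itvco a b : set R).
Proof.
apply: (@bounded_setP _ (`|a| + `|b|)) => t; rewrite /itvco /= in_itv /= => /andP[h1 h2].
have := ler_norm b; have := ler_norm (- a); rewrite normrN.
have := normr_ge0 a; have := normr_ge0 b; rewrite ler_norml; lra.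
Qed.

Lemma itvco_measurable a b : measurable (itvco a b).
Proof. exact: measurable_itv. Qed.

Lemma mm_itvco_split a c b i : a <= c <= b ->
  mm_val rho (itvco a b) i i = mm_val rho (itvco a c) i i + mm_val rho (itvco c b) i i.
Proof.
move=> /andP[ac cb]; rewrite -mm_diagU; try exact: itvco_measurable; try exact: itvco_bounded.
- congr (mm_val _ _ _ _); apply/seteqP; split=> t; rewrite /itvco /= !in_itv /=.
    by move=> /andP[h1 h2]; have [tc|ct] := ltP t c; [left|right]; rewrite ?h1 ?h2 ?tc ?ct.
  by case=> /andP[h1 h2]; rewrite ?h1 ?h2 ?andbT /= ?(lt_le_trans h2) ?(le_trans ac).
- apply/seteqP; split=> t //; rewrite /itvco /= !in_itv /= => -[/andP[_ h1] /andP[h2 _]].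
  by move: h1; rewrite ltNge h2.
Qed.

(** Bisection: an interval of positive mass contains arbitrarily short ones with at
    least the same density. By [mm_mass_le] this density bounds [Im (M i i)] from
    below at points of the upper half-plane that converge to a point of [[a, b]],
    where it vanishes. *)
Lemma mm_vanish_itv a b i : a <= b -> (forall X, a <= X <= b -> Im_vanishes_at X i) ->
  mm_val rho (itvco a b) i i = 0.
Proof.
move=> ab H; apply/eqP; apply: contraT => nu0.
set w := b - a; have w0 : 0 <= w by rewrite subr_ge0.
set eta := mm_val rho (itvco a b) i i.
have eta0 : 0 < eta by rewrite lt0r nu0 mm_diag_ge0 //; [exact: itvco_measurable|exact: itvco_bounded].
pose I n x := mm_val rho (itvco x (x + w / 2 ^+ n)) i i.
pose Q n x x' := eta / 2 ^+ n <= I n x ->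
   eta / 2 ^+ n.+1 <= I n.+1 x' /\
       (x <= x' /\ x' + w / 2 ^+ n.+1 <= x + w / 2 ^+ n).
have wn n : 0 <= w / 2 ^+ n by rewrite divr_ge0 ?exprn_ge0.
have step (ns : nat * R) : exists s', Q ns.1 ns.2 s'.
  case: ns => n x; rewrite /Q /=.
  have [A|] := pselect (eta / 2 ^+ n <= I n x); last by exists x.
  have B := half_pow w n; have C := half_pow eta n; have wn1 := wn n.+1.
  have S : I n x = I n.+1 x + I n.+1 (x + w / 2 ^+ n.+1).
    rewrite /I (@mm_itvco_split _ (x + w / 2 ^+ n.+1)); first by rewrite -addrA -B.
    by apply/andP; split; lra.
  have [D|D] := leP (eta / 2 ^+ n.+1) (I n.+1 x).
    by exists x => _; split => //; split; lra.
  exists (x + w / 2 ^+ n.+1) => _; split; last by split; lra.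
  by lra.
have [g gP] := choice step.
pose s := fix s n := if n is m.+1 then g (m, s m) else a.
have sP n : eta / 2 ^+ n <= I n (s n).
  elim: n => [|n IH]; last by have [] := gP (n, s n) IH.
  by rewrite /I /= !expr0 !divr1 /w !(addrC a) !subrK.
have [X XP] : exists X, forall n, s n <= X <= s n + w / 2 ^+ n.
  by apply: nested_intervals => // n; have [] := gP (n, s n) (sP n).
have Xab : a <= X <= b.
  by have := XP 0%N; rewrite /= expr0 divr1 /w addrC subrK.
(* Small enough for the limit of [Im (M i i)] to contradict the density [eta / w]. *)
pose e := eta / (w + 1).
have w1 : 0 < w + 1 by lra.
have e0 : 0 < e by rewrite divr_gt0.
have [d d0 dP] := H X Xab e e0.
have [n nP] : exists n, w / 2 ^+ n < d.
  have [n nP] := pow2_unbounded w d0; exists n.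
  by rewrite ltr_pdivrMr ?exprn_gt0.
have [w00|wgt0] := leP w 0.
  have wE : w = 0 by apply/le_anti; rewrite w00.
  move: (sP 0%N); rewrite /I /= wE mul0r addr0 /itvco set_itvco0.
  rewrite expr0 divr1 => /(lt_le_trans eta0).
  by rewrite /mm_val mxE !measure0 subrr ltxx.
pose y := w / 2 ^+ n.+1; pose x := s n + y.
have y0 : 0 < y by rewrite divr_gt0 // exprn_gt0.
have yy : w / 2 ^+ n = y + y by rewrite half_pow.
have h1 : I n (s n) <= 2 * y * complex.Im (M (x +i* y) i i).
  apply: mm_mass_le => //; first exact: itvco_measurable.
  move=> t; rewrite /itvco /= in_itv /= yy => /andP[t1 t2].
  by rewrite ler_norml /x; apply/andP; split; lra.
have hz : upper_half_plane (x +i* y)%C by [].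
have h2 : `|complex.Im (M (x +i* y) i i)| <= e.
  apply: dP => //.
  have -> : x +i* y - X%:C = (x - X)%:C + 'i%C * y%:C.
    by rewrite (complex_split x y) rcB; ring.
  apply: (le_lt_trans (modcD _ _)); rewrite modcM modc_i mul1r !modc_real (gtr0_norm y0).
  apply: le_lt_trans nP; rewrite yy lerD2r.
  have := XP n; rewrite yy => /andP[X1 X2]; rewrite ler_norml /x; apply/andP; split; lra.
have h3 : 2 * y * complex.Im (M (x +i* y) i i) <= 2 * y * e.
  by rewrite ler_pM2l ?mulr_gt0 //; exact: le_trans (ler_norm _) h2.
have := le_trans (sP n) (le_trans h1 h3).
have -> : 2 * y * e = (w * e) / 2 ^+ n.
  by rewrite [RHS]mulrAC yy; ring.
rewrite ler_pM2r ?invr_gt0 ?exprn_gt0 // /e mulrA ler_pdivlMr // mulrDr mulr1.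
by rewrite (mulrC w) => ?; lra.
Qed.

(** The diagonal masses of a ball vanish by [mm_vanish_itv]; positivity then forces
    the off-diagonal ones to vanish. *)
Lemma support_vanish x d : 0 < d ->
  (forall i X, `|X - x| <= d -> Im_vanishes_at X i) -> ~ mm_support rho x.
Proof.
move=> d0 H /(_ d d0)/negP; apply; apply/eqP.
have mb : measurable (ball x d : set (measurableTypeR R)) by exact: measurable_ball.
have bb : bounded_set (ball x d : set R).
  apply: (@bounded_setP _ (`|x| + d)) => t; rewrite /ball /= => tx.
  by have := ler_normD (t - x) x; rewrite subrK distrC; lra.
have diag0 i : mm_val rho (ball x d) i i = 0.
  have v0 : mm_val rho (itvco (x - d) (x + d)) i i = 0.
    apply: mm_vanish_itv; first by lra.
    by move=> X XP; apply: H; rewrite ler_norml; apply/andP; split; lra.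
  have sub : (ball x d : set R) `<=` itvco (x - d) (x + d).
    by move=> t; rewrite /ball /itvco /= in_itv /= distrC ltr_distl => /andP[/ltW -> ->].
  have E : itvco (x - d) (x + d) = (ball x d : set (measurableTypeR R)) `|` (itvco (x - d) (x + d) `\` ball x d).
    by rewrite setDUK.
  have mD : measurable (itvco (x - d) (x + d) `\` (ball x d : set (measurableTypeR R))).
    by apply: measurableD => //; exact: itvco_measurable.
  have bD : bounded_set (itvco (x - d) (x + d) `\` ball x d : set R).
    apply: (@bounded_setP _ (`|x - d| + `|x + d|)) => t [] /=; rewrite /itvco /= in_itv /= => /andP[h1 h2] _.
    have := ler_norm (x + d); have := ler_norm (- (x - d)); rewrite normrN.
    have := normr_ge0 (x - d); have := normr_ge0 (x + d); rewrite ler_norml; lra.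
  move: v0; rewrite E mm_diagU //; last by rewrite setDE setICA setICr setI0.
  have := mm_diag_ge0 i mb bb; have := mm_diag_ge0 i mD bD; lra.
by apply: psd_diag0; [exact: mm_psd|exact: diag0|exact: diag0].
Qed.

End Support.

(** * Decomposition of a closed set into intervals *)

Section Components.
Variable R : realType.
Implicit Types (x y a b : R) (E Z C : set R) (I J : interval R).

Lemma closed_has_inf C : closed C -> C !=set0 -> has_lbound C -> C (inf C).
Proof.
move=> cC C0 lC; apply: cC => U /nbhs_ballP[e /= e0 eU].
have [y Cy yl] := @inf_adherent R C e e0 (conj C0 lC).
exists y; split => //; apply: eU; rewrite /ball /= ltr_distl.
have := ge_inf lC Cy; move: yl => h1 h2; apply/andP; split; lra.
Qed.

Lemma closed_has_sup C : closed C -> C !=set0 -> has_ubound C -> C (sup C).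
Proof.
move=> cC C0 lC; apply: cC => U /nbhs_ballP[e /= e0 eU].
have [y Cy yl] := @sup_adherent R C e e0 (conj C0 lC).
exists y; split => //; apply: eU; rewrite /ball /= ltr_distl.
have := ub_le_sup lC Cy; move: yl => h1 h2; apply/andP; split; lra.
Qed.

Lemma closed_interval_Rhull C : closed C -> C !=set0 -> closed_interval (Rhull C).
Proof.
move=> cC C0; rewrite /Rhull.
case: (asboolP (has_lbound C)) => [lC|_]; case: (asboolP (has_ubound C)) => [uC|_] //=.
- by rewrite (asboolT (closed_has_inf cC C0 lC)) (asboolT (closed_has_sup cC C0 uC)).
- by rewrite (asboolT (closed_has_inf cC C0 lC)).
- by rewrite (asboolT (closed_has_sup cC C0 uC)).
Qed.

(** Around an interior point of [E], the component extends to both sides. *)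
Lemma component_endpoint E x0 x (e : R) : 0 < e -> connected_component E x0 x ->
  (forall y, `|y - x| < e -> E y) ->
  ~ (lbound (connected_component E x0) x \/ ubound (connected_component E x0) x).
Proof.
move=> e0 Cx sub.
have ball_sub : ball x e `<=` connected_component E x0.
  rewrite (same_connected_component Cx); apply: connected_component_max.
  - exact: ballxx.
  - by move=> y; rewrite /ball /= distrC => /sub.
  - by apply/connected_intervalP; rewrite ball_itv; exact: interval_is_interval.
have bl : ball x e (x - e / 2).
  by rewrite /ball /= opprD addNKr opprK gtr0_norm ?divr_gt0 //; lra.
have br : ball x e (x + e / 2).
  by rewrite /ball /= opprD addNKr normrN gtr0_norm ?divr_gt0 //; lra.
by case=> H; [have := H _ (ball_sub _ bl)|have := H _ (ball_sub _ br)]; lra.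
Qed.

Lemma endpoints_Rhull C x : closed C -> C !=set0 -> endpoints (Rhull C) x ->
  C x /\ (lbound C x \/ ubound C x).
Proof.
move=> cC C0; rewrite /Rhull /endpoints /=.
case: (asboolP (has_lbound C)) => [lC|_]; case: (asboolP (has_ubound C)) => [uC|_] //=.
- case=> ->.
    by split; [exact: closed_has_inf|left => y Cy; exact: ge_inf].
  by split; [exact: closed_has_sup|right => y Cy; exact: ub_le_sup].
- by move=> ->; split; [exact: closed_has_inf|left => y Cy; exact: ge_inf].
- by move=> ->; split; [exact: closed_has_sup|right => y Cy; exact: ub_le_sup].
Qed.

(** The intervals are the connected components of [E]. Their endpoints belong to
    [E] but not to its interior, so they lie in [Z]. *)
Lemma disjoint_closed_intervals E Z : closed E ->
  (forall x, E x -> ~ Z x -> exists2 e : R, 0 < e & forall y, `|y - x| < e -> E y) ->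
  limit_point Z = set0 -> disjoint_closed_interval_union E.
Proof.
move=> cE EZ Z0.
pose CC x := connected_component E x.
have CCne x : E x -> CC x !=set0 by move=> Ex; exists x; exact: connected_component_refl.
have CCcl x : closed (CC x) by exact: component_closed.
have CCK x : [set` Rhull (CC x)] = CC x.
  by apply: RhullK; rewrite inE; apply/connected_intervalP; exact: component_connected.
exists [set I | exists2 x, E x & I = Rhull (CC x)]; split.
- move=> _ [x Ex ->]; rewrite CCK; split; last exact: CCne.
  by apply: closed_interval_Rhull => //; exact: CCne.
- move=> _ _ [x Ex ->] [y Ey ->]; rewrite !CCK => -[z [Cxz Cyz]].
  by congr Rhull; rewrite /CC (same_connected_component Cxz) (same_connected_component Cyz).
- apply/seteqP; split=> x.
    by move=> Ex; exists (Rhull (CC x)); [exists x|rewrite CCK; exact: connected_component_refl].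
  by move=> [_ [y Ey ->]]; rewrite CCK => /connected_component_sub.
- apply/seteqP; split=> // x lx.
  suff : limit_point Z x by rewrite Z0.
  move=> U /lx[y [yx [_ [w Ew ->] yend] Uy]]; exists y; split => //.
  have [Cy ext] := endpoints_Rhull (CCcl w) (CCne w Ew) yend.
  apply: contrapT => nZ.
  have [e e0 eE] := EZ y (connected_component_sub Cy) nZ.
  exact: (component_endpoint e0 Cy eE).
Qed.

End Components.

(** * Reflectionlessness and spectrum on the bands *)

Unset Implicit Arguments.
Set Strict Implicit.

Theorem theorem2p5 (R : realType) (mp mm : R[i] -> R[i])
    (T : R[i] -> 'M[R[i]]_2) (E : set R)
    (hmp : herglotz mp) (hmm : herglotz mm)
    (hT : entire_SL T)
    (hT1 : ~ (forall z, T z = 1)) (hTN1 : ~ (forall z, T z = -1))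
    (hp : forall z, upper_half_plane z -> mp z = lft (T z) (mp z))
    (hm : forall z, upper_half_plane z -> - mm z = lft (T z) (- mm z))
    (hE : E = [set x : R | -2%:R <= \tr (T x%:C) <= 2%:R]) :
  R0C E (mp, mm) /\ disjoint_closed_interval_union E.
Proof.
(* On the real line the discriminant [tr^2 - 4] is real and [E] is the set where
   it is at most 0. *)
pose D (x : R) := complex.Re (disc (T x%:C)).
have trE (x : R) : exists t : R, \tr (T x%:C) = t%:C.
  by have [S SE] := real_entries x hT; exists (S 0 0 + S 1 1); rewrite trace2 !SE rmorphD.
have DE (x : R) : disc (T x%:C) = (D x)%:C.
  rewrite /D /disc; have [t ->] := trE x.
  by have -> : t%:C ^+ 2 - 4 = (t ^+ 2 - 4)%:C by rewrite rmorphB rmorphXn /= rmorph_nat.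
have ED (x : R) : E x <-> D x <= 0.
  rewrite hE /=; have [t tE] := trE x.
  have -> : D x = t ^+ 2 - 4.
    by apply: complexI; rewrite -DE /disc tE rmorphB rmorphXn /= rmorph_nat.
  have -> : (-2%:R <= \tr (T x%:C) <= 2%:R) = (-2 <= t <= 2).
    rewrite tE; have -> : (2%:R : R[i]) = (2 : R)%:C by rewrite rmorph_nat.
    by rewrite -rmorphN /= !lecR.
  split; first by move=> /andP[h1 h2]; nra.
  move=> h; apply/andP; split; nra.
have Dcont (x e : R) : 0 < e -> exists2 d : R, 0 < d & forall y, `|y - x| < d -> `|D y - D x| < e.
  move=> e0; have [l H] := entire_disc hT x%:C.
  have [d d0 dP] := cderiv_ccont H e0; exists d => // y yd.
  have := dP y%:C; rewrite -rcB modc_real => /(_ yd); apply: le_lt_trans.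
  by rewrite /D -ReN -ReD; exact: ler_Re_modc.
pose Z := [set x : R | D x = 0].
have Z0 : limit_point Z = set0.
  apply/seteqP; split => // x lx.
  have [d d0 dP] := disc_isolated hmp hmm hT hT1 hTN1 hp hm x.
  have [y [yx Zy]] := lx _ (nbhsx_ballx x d d0).
  rewrite /ball /= distrC => yd; have := dP y yx yd.
  by rewrite DE Zy eqxx.
split; last first.
  apply: (@disjoint_closed_intervals R E Z _ _ Z0).
    move=> x cx; apply: contrapT => /ED/negP; rewrite -ltNge => Dx.
    have [d d0 dP] := Dcont x (D x) Dx.
    have [y [/ED Ey]] := cx _ (nbhsx_ballx x d d0).
    by rewrite /ball /= distrC => /dP; rewrite ltr_norml ltrBrDl subrr ltNge Ey.
  move=> x /ED Dx nZ.
  have {}Dx : 0 < - D x by rewrite oppr_gt0 lt_neqAle Dx andbT; apply/eqP.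
  have [d d0 dP] := Dcont x _ Dx.
  exists d => // y /dP; rewrite ltr_norml => /andP[_ h]; apply/ED; lra.
split => //.
- have cZ : countable Z.
    suff -> : Z = isolated Z by exact: countable_isolated.
    apply/seteqP; split; last exact: isolatedS.
    move=> x Zx; have : closure Z x by exact: subset_closure.
    by rewrite closure_isolated_limit_point Z0 setU0.
  exists Z; split.
  + by apply: countable_measurable.
  + exact: countable_lebesgue_measure0.
  move=> x /= /not_implyP[/ED Dx N]; apply: contrapT => nZ; apply: N.
  apply: (reflectionless_at hmp hmm hT hp hm (DE x)).
  by rewrite lt_neqAle Dx andbT; apply/eqP.
- move=> x [rho hrho sx]; apply: contrapT => /ED/negP; rewrite -ltNge => Dx.
  have [d d0 dP] := Dcont x (D x) Dx.
  have d2 : 0 < d / 2 by rewrite divr_gt0.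
  apply: (support_vanish hrho d2 _ sx) => i X Xx.
  have DX : 0 < D X.
    have : `|X - x| < d by lra.
    by move=> /dP; rewrite ltr_norml => /andP[h _]; lra.
  exact: (ImM_vanish hmp hmm hT hp hm i (DE X) DX).
Qed.
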